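(* For every $\alpha>0$, the essential norm of the generalized Alexander operator $C_{g_0}:\mathcal{B}_\alpha^0\to\mathcal{B}_\alpha^0$ is $0$.
   Context: $\mathbb{D}=\{z\in\mathbb{C}:|z|<1\}$. For $\alpha>0$, the $\alpha$-Bloch space $\mathcal{B}_\alpha$ is the space of analytic functions $f$ on $\mathbb{D}$ with $\|f\|_{\mathcal{B}_\alpha}:=\sup_{z\in\mathbb{D}}(1-|z|^2)^\alpha|f'(z)|<\infty$. $\mathcal{B}_\alpha^0=\{f\in\mathcal{B}_\alpha: f(0)=0\}$, normed by $\|\cdot\|_{\mathcal{B}_\alpha}$ (a Banach space). Let $g_0(w)=\sum_{j=1}^k a_j+h(w)$, where $k\ge1$, $a_j\in\mathbb{C}$ with $|a_j|>0$, and $h$ is a bounded analytic function on $\mathbb{D}$. The generalized Alexander operator is $C_{g_0}(f)(z)=\int_0^z\frac{f(w)g_0(w)}{w}\,dw$. The essential norm of a bounded operator $T:X\to Y$ between Banach spaces is $\|T\|_e=\inf\{\|T+K\|: K:X\to Y \text{ compact}\}$, $\|\cdot\|$ the operator norm. *)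

(* Defs.v *)
From Stdlib Require Import Reals.
From Coquelicot Require Import Coquelicot.
Open Scope R_scope.

Definition inDisc (z : C) : Prop := Cmod z < 1.

Definition holo_on_D (f : C -> C) : Prop :=
  forall z, inDisc z -> ex_derive (K := C_AbsRing) (V := C_NormedModule) f z.

Definition bloch_set (alpha : R) (f : C -> C) : R -> Prop :=
  fun r => exists (z : C) (l : C), inDisc z /\
    is_derive (K := C_AbsRing) (V := C_NormedModule) f z l /\
    r = Rpower (1 - (Cmod z) ^ 2) alpha * Cmod l.

Definition bloch_norm (alpha : R) (f : C -> C) : Rbar :=
  Lub_Rbar (bloch_set alpha f).

(* Membership in B_alpha^0.  Convention: an analytic function on D is
   represented by a function C -> C that vanishes outside D (canonical
   representative), so that equality of elements is plain equality. *)
Definition inB0 (alpha : R) (f : C -> C) : Prop :=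
  (forall z, ~ inDisc z -> f z = 0%C) /\
  holo_on_D f /\ f 0%C = 0%C /\ is_finite (bloch_norm alpha f).

Definition lin_op (alpha : R) (T : (C -> C) -> (C -> C)) : Prop :=
  (forall f, inB0 alpha f -> inB0 alpha (T f)) /\
  (forall f g, inB0 alpha f -> inB0 alpha g ->
     T (fun z => (f z + g z)%C) = (fun z => (T f z + T g z)%C)) /\
  (forall (c : C) f, inB0 alpha f ->
     T (fun z => (c * f z)%C) = (fun z => (c * T f z)%C)).

Definition op_norm (alpha : R) (T : (C -> C) -> (C -> C)) : Rbar :=
  Lub_Rbar (fun r => exists f, inB0 alpha f /\
     Rbar_le (bloch_norm alpha f) (Finite 1) /\
     bloch_norm alpha (T f) = Finite r).

Definition compact_op (alpha : R) (K : (C -> C) -> (C -> C)) : Prop :=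
  lin_op alpha K /\
  forall u : nat -> (C -> C),
    (forall n, inB0 alpha (u n)) ->
    (forall n, Rbar_le (bloch_norm alpha (u n)) (Finite 1)) ->
    exists (phi : nat -> nat) (g : C -> C),
      (forall n, (phi n < phi (S n))%nat) /\ inB0 alpha g /\
      is_lim_seq
        (fun n => real (bloch_norm alpha
                         (fun z => (K (u (phi n)) z - g z)%C))) 0.

Definition ess_norm (alpha : R) (T : (C -> C) -> (C -> C)) : Rbar :=
  Glb_Rbar (fun r => exists K, compact_op alpha K /\
     op_norm alpha (fun f z => (T f z + K f z)%C) = Finite r).

(* Generalized Alexander operator:
   C_{g0}(f)(z) = int_0^z f(w) g0(w) / w dw, computed along the segment
   w = t z, t in [0,1] (dw = z dt); extended by 0 outside D. *)
Definition alexander_op (g0 : C -> C) (f : C -> C) : C -> C :=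
  fun z =>
    if Rlt_dec (Cmod z) 1 then
      RInt (V := C_R_CompleteNormedModule)
        (fun t : R => (f (RtoC t * z) * g0 (RtoC t * z) / (RtoC t * z) * z)%C)
        0 1
    else 0%C.

(* Main.v *)
(** The operator T = C_{g0} is itself compact, so K = -T makes the essential
    norm 0.  Indeed (T f)' = (f(z)/z) g0, so T f only depends on f through
    f(z)/z.  A sequence in the unit ball of the Bloch space is locally
    equi-Lipschitz, hence has a locally uniformly convergent subsequence, and
    by Cauchy's derivative estimate its derivatives converge locally uniformly
    too; this controls f(z)/z on compact subsets.  Near the circle,
    (1 - |z|^2)^alpha |f(z)| is uniformly small on the ball, because the growth
    of f is of lower order than that of f'.  The complex analysis rests on
    Goursat's theorem for rectangles. *)

Require Import Defs.
From Stdlib Require Import Reals.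
From Coquelicot Require Import Coquelicot.
From Stdlib Require Import Lra Lia Cantor ClassicalEpsilon FunctionalExtensionality.
Open Scope R_scope.

(** * Complex differentiability *)

(** The delicate point is w = 0, where the integrand divides by 0. The function equal to f(w)/w off
    0 and to f'(0) at 0 is shown to be continuous at 0, but its differentiability there is never
    established. Primitives on the disc are therefore built for functions that are merely continuous
    at 0, which requires Goursat's theorem for rectangles with a corner at 0. Cauchy's derivative
    estimate comes from integrals over squares, with the lower bound 4 for the modulus of the
    integral of 1/w. The constant in |f'| <= 4M/r is not sharp, which is harmless since only
    convergence to 0 matters. Near the circle one argument serves every alpha, without separating
    alpha < 1, alpha = 1 and alpha > 1. Between radius r and z the derivative is at most N divided
    by the weight at z, so after weighting, this part of f(z) costs at most N(1 - r). The value at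
    radius r is bounded once r is fixed, and is multiplied by a weight that tends to 0. *)

Definition cderiv (f : C -> C) (z l : C) : Prop :=
  forall eps, 0 < eps -> exists d, 0 < d /\ forall w, Cmod (w - z)%C < d ->
    Cmod (f w - f z - (w - z) * l)%C <= eps * Cmod (w - z)%C.

Definition ccont (f : C -> C) (z : C) : Prop :=
  forall eps, 0 < eps -> exists d, 0 < d /\ forall w, Cmod (w - z)%C < d ->
    Cmod (f w - f z)%C < eps.

(** Bridge between the derivative of the statement and the division-free estimate in which all the
    complex analysis below is carried out. *)
Lemma is_derive_cderiv (f : C -> C) (z l : C) :
  is_derive (K := C_AbsRing) (V := C_NormedModule) f z l <-> cderiv f z l.
Proof.
  split.
  - intros [_ H] eps He.
    destruct (H z (fun P Q => Q) (mkposreal eps He)) as [d Hd].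
    exists d; split; [apply cond_pos|]. intros w Hw. exact (Hd w Hw).
  - intros H. split.
    + apply (is_linear_scal_l (K := C_AbsRing) (V := C_NormedModule)).
    + intros x Hx.
      apply (is_filter_lim_locally_unique (V := AbsRing_NormedModule C_AbsRing)) in Hx.
      subst x. intros eps. destruct (H eps (cond_pos eps)) as [d [Hd Hw]].
      exists (mkposreal d Hd). intros w Hb. exact (Hw w Hb).
Qed.

Lemma Cmod_norm_R (z : C) : norm (V := C_R_NormedModule) z = Cmod z.
Proof. symmetry; apply Cmod_norm. Qed.

Lemma Cmod_sym (x y : C) : Cmod (x - y)%C = Cmod (y - x)%C.
Proof. rewrite <- Cmod_opp. f_equal. ring. Qed.

Lemma Cmod_tri3 (x y z : C) : Cmod (x - z)%C <= Cmod (x - y)%C + Cmod (y - z)%C.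
Proof. replace (x - z)%C with ((x - y) + (y - z))%C by ring. apply Cmod_triangle. Qed.

Lemma Cmod_minus_le (x y : C) : Cmod (x - y)%C <= Cmod x + Cmod y.
Proof. rewrite <- (Cmod_opp y). apply Cmod_triangle. Qed.

Lemma Cmod_reverse (x y : C) : Cmod x - Cmod y <= Cmod (x - y)%C.
Proof.
  generalize (Cmod_triangle (x - y)%C y).
  replace (x - y + y)%C with x by ring. lra.
Qed.

Lemma Cmod_fst (z : C) : Rabs (fst z) <= Cmod z.
Proof. eapply Rle_trans; [apply Rmax_l | apply Rmax_Cmod]. Qed.

Lemma Cmod_snd (z : C) : Rabs (snd z) <= Cmod z.
Proof. eapply Rle_trans; [apply Rmax_r | apply Rmax_Cmod]. Qed.

Lemma Cmod_pair (x y : R) : Cmod (x, y) <= Rabs x + Rabs y.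
Proof.
  replace ((x, y) : C) with (RtoC x + Ci * RtoC y)%C
    by (unfold Ci, RtoC, Cplus, Cmult; simpl; f_equal; ring).
  eapply Rle_trans; [apply Cmod_triangle|].
  rewrite Cmod_mult, Cmod_Ci, !Cmod_R. lra.
Qed.

Lemma Cmod_box (z w : C) :
  Rabs (fst z) <= Rabs (fst w) -> Rabs (snd z) <= Rabs (snd w) -> Cmod z <= Cmod w.
Proof.
  intros H1 H2. unfold Cmod. apply sqrt_le_1_alt.
  apply Rplus_le_compat; rewrite <- !Rsqr_pow2; now apply Rsqr_le_abs_1.
Qed.

Lemma Cminus_0_r (z : C) : (z - 0)%C = z.
Proof. ring. Qed.

Lemma cderiv_eq f z l m : cderiv f z l -> l = m -> cderiv f z m.
Proof. now intros H <-. Qed.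

Lemma cderiv_ccont f z l : cderiv f z l -> ccont f z.
Proof.
  intros H eps He.
  destruct (H 1 Rlt_0_1) as [d [Hd Hw]].
  assert (Hl := Cmod_ge_0 l).
  assert (Hq : 0 < eps / (2 + Cmod l)) by (apply Rdiv_lt_0_compat; lra).
  exists (Rmin d (eps / (2 + Cmod l))). split; [now apply Rmin_glb_lt|].
  intros w Hb.
  assert (H1 := Hw w (Rlt_le_trans _ _ _ Hb (Rmin_l _ _))).
  assert (H2 := Rlt_le_trans _ _ _ Hb (Rmin_r _ _)).
  apply (Rmult_lt_compat_r (2 + Cmod l)) in H2; [|lra].
  replace (eps / (2 + Cmod l) * (2 + Cmod l)) with eps in H2 by (field; lra).
  assert (H3 : Cmod (f w - f z)%C <= Cmod (w - z)%C * (1 + Cmod l)).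
  { replace (f w - f z)%C with ((f w - f z - (w - z) * l) + (w - z) * l)%C by ring.
    eapply Rle_trans; [apply Cmod_triangle|]. rewrite Cmod_mult. lra. }
  assert (H4 := Cmod_ge_0 (w - z)%C). nra.
Qed.

(** A real step h with tolerance |l - m|/4 on each side yields h|l - m| <= h|l - m|/2. Uniqueness
    lets a derivative given by hypothesis, as in a Bloch bound, be replaced by a computed one. *)
Lemma cderiv_unique f z l m : cderiv f z l -> cderiv f z m -> l = m.
Proof.
  intros H1 H2.
  destruct (Req_dec (Cmod (l - m)%C) 0) as [E|E].
  { apply Cmod_eq_0 in E. replace l with ((l - m) + m)%C by ring. rewrite E. ring. }
  assert (P : 0 < Cmod (l - m)%C) by (generalize (Cmod_ge_0 (l - m)%C); lra).
  destruct (H1 (Cmod (l - m)%C / 4)) as [d1 [D1 K1]]; [lra|].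
  destruct (H2 (Cmod (l - m)%C / 4)) as [d2 [D2 K2]]; [lra|].
  assert (D : 0 < Rmin d1 d2) by now apply Rmin_glb_lt.
  set (h := Rmin d1 d2 / 2).
  assert (Hh : 0 < h) by (unfold h; lra).
  assert (Hw : Cmod (z + RtoC h - z)%C = h).
  { replace (z + RtoC h - z)%C with (RtoC h) by ring. rewrite Cmod_R, Rabs_pos_eq; lra. }
  assert (L1 := Rmin_l d1 d2). assert (L2 := Rmin_r d1 d2).
  specialize (K1 (z + RtoC h)%C). specialize (K2 (z + RtoC h)%C).
  rewrite Hw in K1, K2.
  assert (K1' : h < d1) by (unfold h; lra). assert (K2' : h < d2) by (unfold h; lra).
  specialize (K1 K1'). specialize (K2 K2').
  assert (K : h * Cmod (l - m)%C <= h * (Cmod (l - m)%C / 2)).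
  { rewrite <- (Rabs_pos_eq h) at 1 by lra. rewrite <- Cmod_R, <- Cmod_mult.
    replace (RtoC h * (l - m))%C with
      ((f (z + RtoC h) - f z - (z + RtoC h - z) * m) -
       (f (z + RtoC h) - f z - (z + RtoC h - z) * l))%C by ring.
    eapply Rle_trans; [apply Cmod_minus_le|]. lra. }
  nra.
Qed.

Lemma cderiv_ext_loc f g z l :
  (exists d, 0 < d /\ forall w, Cmod (w - z)%C < d -> f w = g w) ->
  cderiv f z l -> cderiv g z l.
Proof.
  intros [d [Hd E]] H eps He. destruct (H eps He) as [d' [Hd' K]].
  exists (Rmin d d'). split; [now apply Rmin_glb_lt|]. intros w Hw.
  rewrite <- !E.
  - apply K. eapply Rlt_le_trans; [exact Hw | apply Rmin_r].
  - replace (z - z)%C with (RtoC 0) by ring. rewrite Cmod_0. lra.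
  - eapply Rlt_le_trans; [exact Hw | apply Rmin_l].
Qed.

Lemma cderiv_const c z : cderiv (fun _ => c) z 0.
Proof.
  intros eps He. exists 1. split; [lra|]. intros w _.
  replace (c - c - (w - z) * 0)%C with (RtoC 0) by ring. rewrite Cmod_0.
  generalize (Cmod_ge_0 (w - z)%C). nra.
Qed.

Lemma cderiv_plus f g z l m :
  cderiv f z l -> cderiv g z m -> cderiv (fun w => f w + g w)%C z (l + m)%C.
Proof.
  intros H1 H2 eps He.
  destruct (H1 (eps / 2)) as [d1 [D1 K1]]; [lra|].
  destruct (H2 (eps / 2)) as [d2 [D2 K2]]; [lra|].
  exists (Rmin d1 d2). split; [now apply Rmin_glb_lt|]. intros w Hw.
  specialize (K1 w (Rlt_le_trans _ _ _ Hw (Rmin_l _ _))).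
  specialize (K2 w (Rlt_le_trans _ _ _ Hw (Rmin_r _ _))).
  replace (f w + g w - (f z + g z) - (w - z) * (l + m))%C with
    ((f w - f z - (w - z) * l) + (g w - g z - (w - z) * m))%C by ring.
  eapply Rle_trans; [apply Cmod_triangle|]. lra.
Qed.

Lemma cderiv_scal c f z l : cderiv f z l -> cderiv (fun w => c * f w)%C z (c * l)%C.
Proof.
  intros H eps He. assert (Hc := Cmod_ge_0 c).
  assert (P : 0 < eps / (1 + Cmod c)) by (apply Rdiv_lt_0_compat; lra).
  destruct (H _ P) as [d [D K]].
  exists d. split; [exact D|]. intros w Hw. specialize (K w Hw).
  replace (c * f w - c * f z - (w - z) * (c * l))%C with
    (c * (f w - f z - (w - z) * l))%C by ring.
  rewrite Cmod_mult.
  apply Rle_trans with (Cmod c * (eps / (1 + Cmod c) * Cmod (w - z)%C)).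
  - now apply Rmult_le_compat_l.
  - replace eps with (eps / (1 + Cmod c) * (1 + Cmod c)) at 2 by (field; lra).
    assert (Hw0 := Cmod_ge_0 (w - z)%C).
    assert (0 <= eps / (1 + Cmod c) * Cmod (w - z)%C) by (apply Rmult_le_pos; lra). nra.
Qed.

Lemma cderiv_opp f z l : cderiv f z l -> cderiv (fun w => - f w)%C z (- l)%C.
Proof.
  intros H. apply (cderiv_scal (- (1))%C) in H.
  replace (- l)%C with (- (1) * l)%C by ring.
  eapply cderiv_ext_loc; [|exact H].
  exists 1; split; [lra|]; intros; ring.
Qed.

Lemma cderiv_minus f g z l m :
  cderiv f z l -> cderiv g z m -> cderiv (fun w => f w - g w)%C z (l - m)%C.
Proof. intros H1 H2. apply cderiv_plus; [exact H1 | now apply cderiv_opp]. Qed.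

Lemma cderiv_mult f g z l m :
  cderiv f z l -> cderiv g z m -> cderiv (fun w => f w * g w)%C z (l * g z + f z * m)%C.
Proof.
  intros H1 H2 eps He.
  assert (Hg := Cmod_ge_0 (g z)). assert (Hf := Cmod_ge_0 (f z)). assert (Hl := Cmod_ge_0 l).
  (* The tolerances give eps/3 to each of three terms: the error of f times g w, the cross term, and
     f z times the error of g. The [Rmin 1] bounds |g w| by 1 + |g z|. *)
  destruct (cderiv_ccont _ _ _ H2 (Rmin 1 (eps / (3 * (1 + Cmod l))))) as [d0 [D0 K0]].
  { apply Rmin_glb_lt; [lra | apply Rdiv_lt_0_compat; lra]. }
  destruct (H1 (eps / (3 * (1 + Cmod (g z))))) as [d1 [D1 K1]]; [apply Rdiv_lt_0_compat; lra|].
  destruct (H2 (eps / (3 * (1 + Cmod (f z))))) as [d2 [D2 K2]]; [apply Rdiv_lt_0_compat; lra|].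
  exists (Rmin d0 (Rmin d1 d2)). split; [now repeat apply Rmin_glb_lt|]. intros w Hw.
  assert (A0 := Rmin_l d0 (Rmin d1 d2)). assert (A1 := Rmin_r d0 (Rmin d1 d2)).
  assert (A2 := Rmin_l d1 d2). assert (A3 := Rmin_r d1 d2).
  specialize (K0 w ltac:(lra)). specialize (K1 w ltac:(lra)). specialize (K2 w ltac:(lra)).
  assert (B0 := Rmin_l 1 (eps / (3 * (1 + Cmod l)))).
  assert (B1 := Rmin_r 1 (eps / (3 * (1 + Cmod l)))).
  assert (Hgw : Cmod (g w) <= 1 + Cmod (g z)) by (generalize (Cmod_reverse (g w) (g z)); lra).
  assert (W := Cmod_ge_0 (w - z)%C).
  replace (f w * g w - f z * g z - (w - z) * (l * g z + f z * m))%C with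
    ((f w - f z - (w - z) * l) * g w + (w - z) * l * (g w - g z)
      + f z * (g w - g z - (w - z) * m))%C by ring.
  eapply Rle_trans; [apply Cmod_triangle|].
  eapply Rle_trans; [apply Rplus_le_compat_r, Cmod_triangle|].
  rewrite !Cmod_mult.
  assert (T1 : Cmod (f w - f z - (w - z) * l)%C * Cmod (g w) <= eps / 3 * Cmod (w - z)%C).
  { apply Rle_trans with (eps / (3 * (1 + Cmod (g z))) * Cmod (w - z)%C * (1 + Cmod (g z))).
    - apply Rmult_le_compat; try apply Cmod_ge_0; assumption.
    - right. field. lra. }
  assert (T3 : Cmod (f z) * Cmod (g w - g z - (w - z) * m)%C <= eps / 3 * Cmod (w - z)%C).
  { apply Rle_trans with ((1 + Cmod (f z)) * (eps / (3 * (1 + Cmod (f z))) * Cmod (w - z)%C)).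
    - apply Rmult_le_compat; try apply Cmod_ge_0; lra.
    - right. field. lra. }
  assert (T2 : Cmod (w - z)%C * Cmod l * Cmod (g w - g z)%C <= eps / 3 * Cmod (w - z)%C).
  { apply Rle_trans with (Cmod (w - z)%C * (1 + Cmod l) * (eps / (3 * (1 + Cmod l)))).
    - apply Rmult_le_compat; try apply Cmod_ge_0; [nra | nra | lra].
    - right. field. lra. }
  lra.
Qed.

Lemma cderiv_id z : cderiv (fun w => w) z 1.
Proof.
  intros eps He. exists 1. split; [lra|]. intros w _.
  replace (w - z - (w - z) * RtoC 1)%C with (RtoC 0) by ring. rewrite Cmod_0.
  generalize (Cmod_ge_0 (w - z)%C). nra.
Qed.

Lemma cderiv_inv (z : C) : z <> 0%C -> cderiv Cinv z (- (/ z * / z))%C.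
Proof.
  intros Hz eps He.
  assert (P : 0 < Cmod z) by now apply Cmod_gt_0.
  set (c := Cmod z) in *.
  (* The error is |w - z|^2 / (|z|^2 |w|). The first radius keeps |w| > c/2, and the second then
     makes the error at most eps |w - z|. *)
  exists (Rmin (c / 2) (eps * c ^ 3 / 2)).
  assert (P3 : 0 < c ^ 3) by now apply pow_lt.
  split; [apply Rmin_glb_lt; [lra|]; apply Rdiv_lt_0_compat; [now apply Rmult_lt_0_compat | lra]|].
  intros w Hw.
  assert (H1 := Rlt_le_trans _ _ _ Hw (Rmin_l _ _)).
  assert (H2 := Rlt_le_trans _ _ _ Hw (Rmin_r _ _)).
  assert (Pw : c / 2 < Cmod w).
  { generalize (Cmod_reverse z w). rewrite (Cmod_sym z w). fold c. lra. }
  assert (Hw0 : w <> 0%C) by (apply Cmod_gt_0; lra).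
  replace (/ w - / z - (w - z) * - (/ z * / z))%C with
    ((w - z) * (w - z) * / (z * z * w))%C by (field; auto).
  assert (Hzzw : (z * z * w)%C <> 0%C) by (repeat apply Cmult_neq_0; assumption).
  rewrite !Cmod_mult, Cmod_inv, !Cmod_mult by exact Hzzw. fold c.
  assert (W := Cmod_ge_0 (w - z)%C).
  assert (Q : 0 < c * c * Cmod w) by (repeat apply Rmult_lt_0_compat; lra).
  apply (Rmult_le_reg_r (c * c * Cmod w)); [exact Q|].
  rewrite Rmult_assoc, Rinv_l by lra.
  assert (Hc2 : c ^ 3 / 2 <= c * c * Cmod w) by (simpl; nra).
  assert (eps * (c ^ 3 / 2) <= eps * (c * c * Cmod w)) by (apply Rmult_le_compat_l; lra).
  assert (Cmod (w - z)%C <= eps * (c * c * Cmod w)) by lra.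
  nra.
Qed.

Lemma ccont_mult f g z : ccont f z -> ccont g z -> ccont (fun w => f w * g w)%C z.
Proof.
  intros H1 H2 eps He.
  assert (Hg := Cmod_ge_0 (g z)). assert (Hf := Cmod_ge_0 (f z)).
  destruct (H1 (eps / (2 * (1 + Cmod (g z))))) as [d1 [D1 K1]]; [apply Rdiv_lt_0_compat; lra|].
  destruct (H2 (Rmin 1 (eps / (2 * (1 + Cmod (f z)))))) as [d2 [D2 K2]].
  { apply Rmin_glb_lt; [lra | apply Rdiv_lt_0_compat; lra]. }
  exists (Rmin d1 d2). split; [now apply Rmin_glb_lt|]. intros w Hw.
  specialize (K1 w (Rlt_le_trans _ _ _ Hw (Rmin_l _ _))).
  specialize (K2 w (Rlt_le_trans _ _ _ Hw (Rmin_r _ _))).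
  assert (B0 := Rmin_l 1 (eps / (2 * (1 + Cmod (f z))))).
  assert (B1 := Rmin_r 1 (eps / (2 * (1 + Cmod (f z))))).
  assert (Hgw : Cmod (g w) <= 1 + Cmod (g z)) by (generalize (Cmod_reverse (g w) (g z)); lra).
  replace (f w * g w - f z * g z)%C with ((f w - f z) * g w + f z * (g w - g z))%C by ring.
  eapply Rle_lt_trans; [apply Cmod_triangle|]. rewrite !Cmod_mult.
  assert (T1 : Cmod (f w - f z)%C * Cmod (g w) < eps / 2).
  { apply Rle_lt_trans with (Cmod (f w - f z)%C * (1 + Cmod (g z))).
    - apply Rmult_le_compat_l; [apply Cmod_ge_0 | exact Hgw].
    - replace (eps / 2) with (eps / (2 * (1 + Cmod (g z))) * (1 + Cmod (g z))) by (field; lra).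
      apply Rmult_lt_compat_r; lra. }
  assert (T2 : Cmod (f z) * Cmod (g w - g z)%C <= eps / 2).
  { replace (eps / 2) with ((1 + Cmod (f z)) * (eps / (2 * (1 + Cmod (f z))))) by (field; lra).
    apply Rmult_le_compat; try apply Cmod_ge_0; lra. }
  lra.
Qed.

Lemma continuous_ccont (G : C -> C) (p : R -> C) (t : R) :
  ccont G (p t) ->
  continuous (U := C_R_NormedModule) p t ->
  continuous (U := C_R_NormedModule) (fun s => G (p s)) t.
Proof.
  intros HG Hp. apply continuous_comp; [exact Hp|].
  intros P [e He].
  destruct (HG e (cond_pos e)) as [d [D K]].
  (* Balls of the product structure on C are squares; a square of half-side d/2 lies in the disc of
     radius d. *)
  assert (D2 : 0 < d / 2) by lra.
  exists (mkposreal _ D2). intros w [Hw1 Hw2]. apply He.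
  assert (Kw : Cmod (w - p t)%C < d).
  { destruct w as [w1 w2]. destruct (p t) as [p1 p2].
    change (Rabs (w1 - p1) < d / 2) in Hw1. change (Rabs (w2 - p2) < d / 2) in Hw2.
    eapply Rle_lt_trans; [apply Cmod_pair|]. simpl. unfold Rminus in *. lra. }
  specialize (K w Kw). split.
  - change (Rabs (fst (G w - G (p t))%C) < e). eapply Rle_lt_trans; [apply Cmod_fst | exact K].
  - change (Rabs (snd (G w - G (p t))%C) < e). eapply Rle_lt_trans; [apply Cmod_snd | exact K].
Qed.

Lemma continuous_pair (f g : R -> R) (t : R) :
  continuous f t -> continuous g t ->
  continuous (U := C_R_NormedModule) (fun s => (f s, g s)) t.
Proof.
  intros H1 H2 P [e He].
  assert (K1 := proj1 (filterlim_locally f (f t)) H1 e).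
  assert (K2 := proj1 (filterlim_locally g (g t)) H2 e).
  apply (filter_imp (F := locally t) (fun s => ball (f t) e (f s) /\ ball (g t) e (g s))).
  - intros s [A B]. apply He. now split.
  - now apply filter_and.
Qed.

Lemma is_derive_R_C (f : R -> C) (t : R) (l : C) :
  (forall eps, 0 < eps -> exists d, 0 < d /\ forall s, Rabs (s - t) < d ->
     Cmod (f s - f t - RtoC (s - t) * l)%C <= eps * Rabs (s - t)) ->
  is_derive (V := C_R_NormedModule) f t l.
Proof.
  intros H. split.
  - apply (is_linear_scal_l (K := R_AbsRing) (V := C_R_NormedModule)).
  - intros x Hx. apply (is_filter_lim_locally_unique (V := R_NormedModule)) in Hx.
    subst x. intros eps. destruct (H eps (cond_pos eps)) as [d [Hd Hw]].
    exists (mkposreal d Hd). intros s Hs.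
    rewrite Cmod_norm_R. specialize (Hw s Hs).
    eapply Rle_trans; [right | exact Hw]. f_equal.
    unfold minus, scal, plus, opp; simpl.
    unfold prod_scal, prod_plus, prod_opp, scal, plus, opp, mult; simpl.
    unfold Cminus, Cplus, Copp, Cmult, RtoC, mult; simpl.
    f_equal; ring.
Qed.

Lemma is_derive_along (F : C -> C) (z v l : C) (t : R) :
  cderiv F (z + RtoC t * v)%C l ->
  is_derive (V := C_R_NormedModule) (fun s => F (z + RtoC s * v)%C) t (v * l)%C.
Proof.
  intros H. apply is_derive_R_C. intros eps He.
  assert (Hv := Cmod_ge_0 v).
  destruct (H (eps / (1 + Cmod v))) as [d [D K]]; [apply Rdiv_lt_0_compat; lra|].
  exists (d / (1 + Cmod v)). split; [apply Rdiv_lt_0_compat; lra|]. intros s Hs.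
  assert (E : (z + RtoC s * v - (z + RtoC t * v))%C = (RtoC (s - t) * v)%C)
    by (rewrite RtoC_minus; ring).
  assert (EM : Cmod (z + RtoC s * v - (z + RtoC t * v))%C = Rabs (s - t) * Cmod v)
    by (rewrite E, Cmod_mult, Cmod_R; reflexivity).
  assert (Ha := Rabs_pos (s - t)).
  assert (Hd : Rabs (s - t) * Cmod v < d).
  { apply (Rmult_lt_compat_r (1 + Cmod v)) in Hs; [|lra].
    replace (d / (1 + Cmod v) * (1 + Cmod v)) with d in Hs by (field; lra). nra. }
  specialize (K (z + RtoC s * v)%C). rewrite EM in K. specialize (K Hd).
  rewrite E in K.
  replace (RtoC (s - t) * (v * l))%C with (RtoC (s - t) * v * l)%C by ring.
  eapply Rle_trans; [exact K|].
  replace (eps * Rabs (s - t)) with (eps / (1 + Cmod v) * (Rabs (s - t) * (1 + Cmod v))) by (field; lra).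
  apply Rmult_le_compat_l; [apply Rlt_le, Rdiv_lt_0_compat; lra|]. nra.
Qed.

Lemma is_derive_fst_C (f : R -> C) (t : R) (l : C) :
  is_derive (V := C_R_NormedModule) f t l -> is_derive (fun s => fst (f s)) t (fst l).
Proof.
  intros H. unfold is_derive in *.
  eapply filterdiff_ext_lin.
  - apply (filterdiff_comp' (V := C_R_NormedModule) (W := R_NormedModule) f fst t
      (fun y => scal y l) fst H).
    apply filterdiff_linear. apply is_linear_fst.
  - intros y. reflexivity.
Qed.

(* The scalar mean value theorem, applied to the component of [f] in the
   direction of [f w - f z]. *)
Lemma cderiv_mean_value f z w M :
  (forall t, 0 <= t <= 1 -> exists l, cderiv f (z + RtoC t * (w - z))%C l /\ Cmod l <= M) ->
  Cmod (f w - f z)%C <= M * Cmod (w - z)%C.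
Proof.
  intros H.
  set (c := Cconj (f w - f z)%C).
  set (psi := fun t : R => Re (c * f (z + RtoC t * (w - z))%C)%C).
  assert (Hd : forall t, 0 <= t <= 1 -> exists l, cderiv f (z + RtoC t * (w - z))%C l /\ Cmod l <= M
      /\ is_derive psi t (Re (c * ((w - z) * l))%C)).
  { intros t Ht. destruct (H t Ht) as [l [H1 H2]]. exists l. split; [exact H1|]. split; [exact H2|].
    assert (K := is_derive_along (fun u => c * f u)%C z (w - z)%C (c * l)%C t (cderiv_scal _ _ _ _ H1)).
    replace (Re (c * ((w - z) * l))%C) with (fst ((w - z) * (c * l))%C)
      by (unfold Re; f_equal; ring).
    exact (is_derive_fst_C _ _ _ K). }
  (* [MVT_gen] wants the derivative as a total function of t, so derivatives are chosen on [0,1] and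
     set to 0 elsewhere. *)
  set (l0 := fun t => match excluded_middle_informative (0 <= t <= 1) with
    | left p => proj1_sig (constructive_indefinite_description _ (Hd t p))
    | right _ => RtoC 0 end).
  assert (Hl0 : forall t, 0 <= t <= 1 -> Cmod (l0 t) <= M /\ is_derive psi t (Re (c * ((w - z) * l0 t))%C)).
  { intros t Ht. unfold l0. destruct excluded_middle_informative as [p|n]; [|contradiction].
    destruct constructive_indefinite_description as [l Hl]; simpl. tauto. }
  destruct (MVT_gen psi 0 1 (fun t => Re (c * ((w - z) * l0 t))%C)) as [t [Ht E]].
  - intros x. rewrite Rmin_left, Rmax_right by lra. intros Hx. apply Hl0. lra.
  - intros x. rewrite Rmin_left, Rmax_right by lra. intros Hx.
    apply continuity_pt_filterlim.
    apply (ex_derive_continuous (V := R_NormedModule) psi). eexists. apply Hl0. lra.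
  - rewrite Rmin_left, Rmax_right in Ht by lra.
    assert (E2 : psi 1 - psi 0 = Cmod (f w - f z)%C ^ 2).
    { unfold psi.
      replace (z + RtoC 1 * (w - z))%C with w by ring.
      replace (z + RtoC 0 * (w - z))%C with z by ring.
      rewrite Cmod2_alt. unfold c.
      unfold Cconj, Cminus, Cplus, Copp, Cmult, Re, Im; simpl. ring. }
    rewrite E2 in E.
    assert (B : Re (c * ((w - z) * l0 t))%C <= Cmod (f w - f z)%C * (M * Cmod (w - z)%C)).
    { eapply Rle_trans; [apply Rle_abs|]. eapply Rle_trans; [apply re_le_Cmod|].
      rewrite !Cmod_mult. unfold c. rewrite Cmod_conj.
      apply Rmult_le_compat_l; [apply Cmod_ge_0|].
      rewrite Rmult_comm. apply Rmult_le_compat_r; [apply Cmod_ge_0|]. apply Hl0; exact Ht. }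
    assert (P := Cmod_ge_0 (f w - f z)%C).
    destruct (Req_dec (Cmod (f w - f z)%C) 0) as [Z|Z].
    + rewrite Z. apply Rmult_le_pos; [|apply Cmod_ge_0].
      destruct (Hl0 t Ht) as [HM _]. generalize (Cmod_ge_0 (l0 t)); lra.
    + nra.
Qed.

(** * Integration along rectangles *)

Notation CInt := (RInt (V := C_R_CompleteNormedModule)).
Notation is_CInt := (is_RInt (V := C_R_NormedModule)).
Notation ex_CInt := (ex_RInt (V := C_R_NormedModule)).
Notation between a b x := (Rmin a b <= x <= Rmax a b).

(** The integral is linear over R; a complex constant is passed through it by real and imaginary
    parts. *)
Lemma is_CInt_Cmult (c : C) (f : R -> C) (a b : R) (I : C) :
  is_CInt f a b I -> is_CInt (fun t => c * f t)%C a b (c * I)%C.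
Proof.
  intros H.
  assert (H1 := is_RInt_fct_extend_fst (U := R_NormedModule) (V := R_NormedModule) _ _ _ _ H).
  assert (H2 := is_RInt_fct_extend_snd (U := R_NormedModule) (V := R_NormedModule) _ _ _ _ H).
  apply (is_RInt_fct_extend_pair (U := R_NormedModule) (V := R_NormedModule)).
  - exact (is_RInt_minus _ _ _ _ _ _ (is_RInt_scal _ _ _ (fst c) _ H1) (is_RInt_scal _ _ _ (snd c) _ H2)).
  - exact (is_RInt_plus _ _ _ _ _ _ (is_RInt_scal _ _ _ (fst c) _ H2) (is_RInt_scal _ _ _ (snd c) _ H1)).
Qed.

Lemma CInt_Cmult (c : C) (f : R -> C) (a b : R) :
  ex_CInt f a b -> CInt (fun t => c * f t)%C a b = (c * CInt f a b)%C.
Proof.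
  intros H. apply is_RInt_unique, is_CInt_Cmult, (RInt_correct (V := C_R_CompleteNormedModule)), H.
Qed.

Lemma CInt_bound (f : R -> C) (a b M : R) :
  ex_CInt f a b -> (forall x, between a b x -> Cmod (f x) <= M) ->
  Cmod (CInt f a b) <= M * Rabs (b - a).
Proof.
  intros H HM. rewrite <- Cmod_norm_R, Rmult_comm.
  apply (norm_RInt_le_const_abs (V := C_R_NormedModule) f a b).
  - intros x Hx. rewrite Cmod_norm_R. now apply HM.
  - apply (RInt_correct (V := C_R_CompleteNormedModule)), H.
Qed.

Definition hint (G : C -> C) (y a b : R) : C := CInt (fun x => G (x, y)) a b.
Definition vint (G : C -> C) (x c d : R) : C := CInt (fun y => G (x, y)) c d.
(** The contour integral along the boundary, counterclockwise when a < b and c < d; [Ci] comes from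
    dw = i dy on vertical sides. The ends are not assumed ordered, because the primitive on the disc
    uses rectangles from 0 into all four quadrants. *)
Definition rect (G : C -> C) (a b c d : R) : C :=
  (hint G c a b + Ci * vint G b c d - hint G d a b - Ci * vint G a c d)%C.

Lemma ex_hint G y a b :
  (forall x, between a b x -> ccont G (x, y)) -> ex_CInt (fun x => G (x, y)) a b.
Proof.
  intros H. apply (ex_RInt_continuous (V := C_R_CompleteNormedModule)).
  intros x Hx. apply (continuous_ccont G (fun s => (s, y))); [now apply H|].
  apply continuous_pair; [apply continuous_id | apply continuous_const].
Qed.

Lemma ex_vint G x c d :
  (forall y, between c d y -> ccont G (x, y)) -> ex_CInt (fun y => G (x, y)) c d.
Proof.
  intros H. apply (ex_RInt_continuous (V := C_R_CompleteNormedModule)).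
  intros y Hy. apply (continuous_ccont G (fun s => (x, s))); [now apply H|].
  apply continuous_pair; [apply continuous_const | apply continuous_id].
Qed.

Lemma between_sub a b m x : between a b m -> between a m x \/ between m b x -> between a b x.
Proof. unfold Rmin, Rmax. repeat destruct Rle_dec; lra. Qed.

Lemma hint_Chasles G y a m b :
  (forall x, between a m x \/ between m b x -> ccont G (x, y)) ->
  hint G y a b = (hint G y a m + hint G y m b)%C.
Proof.
  intros H. symmetry. apply (RInt_Chasles (V := C_R_CompleteNormedModule));
    apply ex_hint; auto.
Qed.

Lemma vint_Chasles G x c n d :
  (forall y, between c n y \/ between n d y -> ccont G (x, y)) ->
  vint G x c d = (vint G x c n + vint G x n d)%C.
Proof.
  intros H. symmetry. apply (RInt_Chasles (V := C_R_CompleteNormedModule));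
    apply ex_vint; auto.
Qed.

Lemma rect_split_x G a m b c d :
  between a b m ->
  (forall x, between a b x -> ccont G (x, c)) -> (forall x, between a b x -> ccont G (x, d)) ->
  rect G a b c d = (rect G a m c d + rect G m b c d)%C.
Proof.
  intros Hm H1 H2. unfold rect.
  rewrite (hint_Chasles G c a m b), (hint_Chasles G d a m b).
  - ring.
  - intros x Hx. apply H2. now apply between_sub with m.
  - intros x Hx. apply H1. now apply between_sub with m.
Qed.

Lemma rect_split_y G a b c n d :
  between c d n ->
  (forall y, between c d y -> ccont G (a, y)) -> (forall y, between c d y -> ccont G (b, y)) ->
  rect G a b c d = (rect G a b c n + rect G a b n d)%C.
Proof.
  intros Hm H1 H2. unfold rect.
  rewrite (vint_Chasles G a c n d), (vint_Chasles G b c n d).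
  - ring.
  - intros x Hx. apply H2. now apply between_sub with n.
  - intros x Hx. apply H1. now apply between_sub with n.
Qed.

Lemma hint_swap G y a b :
  (forall x, between a b x -> ccont G (x, y)) -> hint G y b a = (- hint G y a b)%C.
Proof.
  intros H. symmetry. apply (opp_RInt_swap (V := C_R_CompleteNormedModule)). now apply ex_hint.
Qed.

Lemma vint_swap G x c d :
  (forall y, between c d y -> ccont G (x, y)) -> vint G x d c = (- vint G x c d)%C.
Proof.
  intros H. symmetry. apply (opp_RInt_swap (V := C_R_CompleteNormedModule)). now apply ex_vint.
Qed.

Definition ccont_on (G : C -> C) (a b c d : R) : Prop :=
  forall x y, between a b x -> between c d y -> ccont G (x, y).

Lemma between_l a b : between a b a.
Proof. split; [apply Rmin_l | apply Rmax_l]. Qed.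

Lemma between_r a b : between a b b.
Proof. split; [apply Rmin_r | apply Rmax_r]. Qed.

Lemma rect_swap_x G a b c d : ccont_on G a b c d -> rect G b a c d = (- rect G a b c d)%C.
Proof.
  intros H. unfold rect. rewrite (hint_swap G c a b), (hint_swap G d a b).
  - ring.
  - intros; apply H; [assumption | apply between_r].
  - intros; apply H; [assumption | apply between_l].
Qed.

Lemma rect_swap_y G a b c d : ccont_on G a b c d -> rect G a b d c = (- rect G a b c d)%C.
Proof.
  intros H. unfold rect. rewrite (vint_swap G a c d), (vint_swap G b c d).
  - ring.
  - intros; apply H; [apply between_r | assumption].
  - intros; apply H; [apply between_l | assumption].
Qed.

(** Hypotheses restricted to the boundary allow an integrand that is singular inside, such as 1/w
    around 0. *)
Definition on_boundary (a b c d : R) (w : C) : Prop :=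
  between a b (fst w) /\ between c d (snd w) /\
  (fst w = a \/ fst w = b \/ snd w = c \/ snd w = d).

Lemma boundary_sides (Q : C -> Prop) a b c d :
  (forall w, on_boundary a b c d w -> Q w) ->
  (forall x, between a b x -> Q (x, c) /\ Q (x, d)) /\
  (forall y, between c d y -> Q (a, y) /\ Q (b, y)).
Proof.
  intros H.
  assert (Al := between_l a b). assert (Ar := between_r a b).
  assert (Cl := between_l c d). assert (Cr := between_r c d).
  split; intros s Hs; split; apply H; unfold on_boundary; simpl; tauto.
Qed.

Lemma rect_bound G a b c d M :
  (forall w, on_boundary a b c d w -> ccont G w) ->
  (forall w, on_boundary a b c d w -> Cmod (G w) <= M) ->
  Cmod (rect G a b c d) <= 2 * M * (Rabs (b - a) + Rabs (d - c)).
Proof.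
  intros H HM. unfold rect.
  destruct (boundary_sides _ _ _ _ _ H) as [Hx Hy].
  destruct (boundary_sides _ _ _ _ _ HM) as [Mx My].
  assert (B1 : Cmod (hint G c a b) <= M * Rabs (b - a))
    by (apply CInt_bound; [apply ex_hint|]; intros; [apply Hx | apply Mx]; assumption).
  assert (B2 : Cmod (hint G d a b) <= M * Rabs (b - a))
    by (apply CInt_bound; [apply ex_hint|]; intros; [apply Hx | apply Mx]; assumption).
  assert (B3 : Cmod (vint G a c d) <= M * Rabs (d - c))
    by (apply CInt_bound; [apply ex_vint|]; intros; [apply Hy | apply My]; assumption).
  assert (B4 : Cmod (vint G b c d) <= M * Rabs (d - c))
    by (apply CInt_bound; [apply ex_vint|]; intros; [apply Hy | apply My]; assumption).
  eapply Rle_trans; [apply Cmod_minus_le|].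
  eapply Rle_trans; [apply Rplus_le_compat_r, Cmod_minus_le|].
  eapply Rle_trans; [apply Rplus_le_compat_r, Rplus_le_compat_r, Cmod_triangle|].
  rewrite !Cmod_mult, Cmod_Ci. lra.
Qed.

Lemma rect_minus G A a b c d :
  (forall w, on_boundary a b c d w -> ccont G w) ->
  (forall w, on_boundary a b c d w -> ccont A w) ->
  rect (fun w => G w - A w)%C a b c d = (rect G a b c d - rect A a b c d)%C.
Proof.
  intros H1 H2. unfold rect, hint, vint.
  destruct (boundary_sides _ _ _ _ _ H1) as [Gx Gy].
  destruct (boundary_sides _ _ _ _ _ H2) as [Ax Ay].
  assert (E : forall f g s t, ex_CInt f s t -> ex_CInt g s t ->
    CInt (fun x => f x - g x)%C s t = (CInt f s t - CInt g s t)%C)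
    by (intros; now apply (RInt_minus (V := C_R_CompleteNormedModule))).
  rewrite (E (fun x => G (x, c)) (fun x => A (x, c)))
    by (apply ex_hint; intros; first [now apply Gx | now apply Ax]).
  rewrite (E (fun x => G (x, d)) (fun x => A (x, d)))
    by (apply ex_hint; intros; first [now apply Gx | now apply Ax]).
  rewrite (E (fun y => G (a, y)) (fun y => A (a, y)))
    by (apply ex_vint; intros; first [now apply Gy | now apply Ay]).
  rewrite (E (fun y => G (b, y)) (fun y => A (b, y)))
    by (apply ex_vint; intros; first [now apply Gy | now apply Ay]).
  ring.
Qed.

Lemma rect_ext G A a b c d :
  (forall w, on_boundary a b c d w -> G w = A w) -> rect G a b c d = rect A a b c d.
Proof.
  intros H. destruct (boundary_sides _ _ _ _ _ H) as [Hx Hy].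
  assert (E : forall f g s t, (forall x, between s t x -> f x = g x) -> CInt f s t = CInt g s t).
  { intros f g s t E. apply (RInt_ext (V := C_R_CompleteNormedModule)). intros x Hx'. apply E. lra. }
  unfold rect, hint, vint.
  rewrite (E (fun x => G (x, c)) (fun x => A (x, c))) by (intros; now apply Hx).
  rewrite (E (fun x => G (x, d)) (fun x => A (x, d))) by (intros; now apply Hx).
  rewrite (E (fun y => G (a, y)) (fun y => A (a, y))) by (intros; now apply Hy).
  rewrite (E (fun y => G (b, y)) (fun y => A (b, y))) by (intros; now apply Hy).
  reflexivity.
Qed.

Lemma rect_scal c0 G a b c d :
  (forall w, on_boundary a b c d w -> ccont G w) ->
  rect (fun w => c0 * G w)%C a b c d = (c0 * rect G a b c d)%C.
Proof.
  intros H. unfold rect, hint, vint.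
  destruct (boundary_sides _ _ _ _ _ H) as [Gx Gy].
  rewrite (CInt_Cmult c0 (fun x => G (x, c))) by (apply ex_hint; intros; now apply Gx).
  rewrite (CInt_Cmult c0 (fun x => G (x, d))) by (apply ex_hint; intros; now apply Gx).
  rewrite (CInt_Cmult c0 (fun y => G (a, y))) by (apply ex_vint; intros; now apply Gy).
  rewrite (CInt_Cmult c0 (fun y => G (b, y))) by (apply ex_vint; intros; now apply Gy).
  ring.
Qed.

Lemma hint_primitive F G y a b :
  (forall x, between a b x -> cderiv F (x, y) (G (x, y))) ->
  (forall x, between a b x -> ccont G (x, y)) ->
  hint G y a b = (F (b, y) - F (a, y))%C.
Proof.
  intros HF HG. unfold hint. apply (is_RInt_unique (V := C_R_CompleteNormedModule)).
  change (F (b, y) - F (a, y))%C with (minus (G := C_R_NormedModule) (F (b, y)) (F (a, y))).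
  apply (is_RInt_derive (V := C_R_CompleteNormedModule) (fun x => F (x, y))).
  - intros x Hx.
    assert (E : forall s : R, ((0, y) + RtoC s * 1)%C = (s, y))
      by (intros s; unfold Cplus, Cmult, RtoC; simpl; f_equal; ring).
    apply (is_derive_ext (V := C_R_NormedModule) (fun s => F ((0, y) + RtoC s * 1)%C)).
    + intros s. now rewrite E.
    + replace (G (x, y)) with (1 * G (x, y))%C by ring.
      apply (is_derive_along F (0, y) 1%C). rewrite E. now apply HF.
  - intros x Hx. apply (continuous_ccont G (fun s => (s, y))); [now apply HG|].
    apply continuous_pair; [apply continuous_id | apply continuous_const].
Qed.

Lemma vint_primitive F G x c d :
  (forall y, between c d y -> cderiv F (x, y) (G (x, y))) ->
  (forall y, between c d y -> ccont G (x, y)) ->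
  (Ci * vint G x c d)%C = (F (x, d) - F (x, c))%C.
Proof.
  intros HF HG.
  assert (HC : forall y, between c d y -> continuous (U := C_R_NormedModule) (fun s => G (x, s)) y).
  { intros y Hy. apply (continuous_ccont G (fun s => (x, s))); [now apply HG|].
    apply continuous_pair; [apply continuous_const | apply continuous_id]. }
  (* The y-derivative of F is i G, so -i F is the real-variable primitive of G on a vertical
     side. *)
  assert (H : is_CInt (fun y => G (x, y)) c d (- Ci * F (x, d) - (- Ci * F (x, c)))%C).
  { apply (is_RInt_derive (V := C_R_CompleteNormedModule) (fun y => - Ci * F (x, y))%C); [|exact HC].
    intros y Hy.
    assert (E : forall s : R, ((x, 0) + RtoC s * Ci)%C = (x, s))
      by (intros s; unfold Cplus, Cmult, RtoC, Ci; simpl; f_equal; ring).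
    apply (is_derive_ext (V := C_R_NormedModule) (fun s => - Ci * F ((x, 0) + RtoC s * Ci))%C).
    + intros s. now rewrite E.
    + replace (G (x, y)) with (Ci * (- Ci * G (x, y)))%C
        by (unfold Cplus, Copp, Cmult, Ci; destruct (G (x, y)); simpl; f_equal; ring).
      apply (is_derive_along (fun w => - Ci * F w)%C (x, 0) Ci). rewrite E.
      apply cderiv_scal. now apply HF. }
  apply (is_RInt_unique (V := C_R_CompleteNormedModule)) in H. unfold vint.
  transitivity (Ci * (- Ci * F (x, d) - (- Ci * F (x, c))))%C; [now rewrite <- H|].
  destruct (F (x, d)), (F (x, c)). unfold Cminus, Cplus, Copp, Cmult, Ci; simpl; f_equal; ring.
Qed.

Lemma rect_primitive F G a b c d :
  ccont_on G a b c d -> (forall x y, between a b x -> between c d y -> cderiv F (x, y) (G (x, y))) ->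
  rect G a b c d = 0%C.
Proof.
  intros HG HF. unfold rect.
  assert (Al := between_l a b). assert (Ar := between_r a b).
  assert (Cl := between_l c d). assert (Cr := between_r c d).
  rewrite (hint_primitive F), (hint_primitive F), (vint_primitive F), (vint_primitive F); auto.
  ring.
Qed.

(** * Bisection of rectangles *)

Lemma nested_intervals (a b : nat -> R) :
  (forall n, a n <= a (S n)) -> (forall n, b (S n) <= b n) -> (forall n, a n <= b n) ->
  exists x, forall n, a n <= x <= b n.
Proof.
  intros Ha Hb Hab.
  assert (B0 : forall n, b n <= b O) by (induction n; [lra | generalize (Hb n); lra]).
  assert (AB : forall n m, a m <= b n).
  { intros n m. apply Rle_trans with (a (m + n)%nat).
    - induction n; [rewrite Nat.add_0_r; lra|].
      rewrite Nat.add_succ_r. eapply Rle_trans; [exact IHn | apply Ha].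
    - apply Rle_trans with (b (m + n)%nat); [apply Hab|].
      induction m; [simpl; lra|]. eapply Rle_trans; [apply Hb | exact IHm]. }
  destruct (ex_finite_lim_seq_incr a (b O) Ha (fun n => AB O n)) as [x Hx].
  exists x. intros n. split.
  - now apply (is_lim_seq_incr_compare a).
  - apply (is_lim_seq_le a (fun _ => b n) x (b n)); [intros; apply AB | exact Hx | apply is_lim_seq_const].
Qed.

(** If P failed, some quarter would fail, then a quarter of that one, and so on. The failing
    rectangles shrink to a point, at which the local hypothesis says that P holds. *)
Lemma rect_bisection (P : R -> R -> R -> R -> Prop) a b c d :
  a <= b -> c <= d ->
  (forall a b c d, a <= b -> c <= d ->
     P a ((a + b) / 2) c ((c + d) / 2) -> P a ((a + b) / 2) ((c + d) / 2) d ->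
     P ((a + b) / 2) b c ((c + d) / 2) -> P ((a + b) / 2) b ((c + d) / 2) d -> P a b c d) ->
  (forall x y, a <= x <= b -> c <= y <= d -> exists delta, 0 < delta /\
     forall a' b' c' d', a' <= x <= b' -> c' <= y <= d' -> b' - a' < delta -> d' - c' < delta ->
     P a' b' c' d') ->
  P a b c d.
Proof.
  intros Hab Hcd Hjoin Hloc. apply NNPP. intros HN.
  set (half := fun (q : R * R) (up : bool) =>
    if up then ((fst q + snd q) / 2, snd q) else (fst q, (fst q + snd q) / 2)).
  set (Q := fun q : (R * R) * (R * R) => P (fst (fst q)) (snd (fst q)) (fst (snd q)) (snd (snd q))).
  set (good := fun q : (R * R) * (R * R) =>
    fst (fst q) <= snd (fst q) /\ fst (snd q) <= snd (snd q) /\ ~ Q q).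
  assert (Hstep : forall q, good q -> exists u v, ~ Q (half (fst q) u, half (snd q) v)).
  { intros q [G1 [G2 G3]]. apply NNPP. intros HA. apply G3. unfold Q.
    assert (HA' : forall u v, Q (half (fst q) u, half (snd q) v)).
    { intros u v. apply NNPP. intros K. apply HA. now exists u, v. }
    apply Hjoin; [exact G1 | exact G2 | exact (HA' false false) | exact (HA' false true)
      | exact (HA' true false) | exact (HA' true true)]. }
  assert (Hhalf : forall q u, fst q <= snd q -> fst q <= fst (half q u) /\ snd (half q u) <= snd q
    /\ fst (half q u) <= snd (half q u) /\ snd (half q u) - fst (half q u) = (snd q - fst q) / 2).
  { intros q [|] H; simpl; lra. }
  (* Iterating on the subset type carries the failure of P along with each rectangle. *)
  assert (Hnext : forall q : {q | good q}, exists r : {q | good q}, exists u v,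
    proj1_sig r = (half (fst (proj1_sig q)) u, half (snd (proj1_sig q)) v)).
  { intros [q Hq]. destruct (Hstep q Hq) as [u [v Huv]]. assert (Hq2 := Hq). destruct Hq2 as [G1 [G2 _]].
    assert (Hr : good (half (fst q) u, half (snd q) v)).
    { split; [|split]; [now apply Hhalf | now apply Hhalf | exact Huv]. }
    exists (exist _ _ Hr), u, v. reflexivity. }
  set (next := fun q => proj1_sig (constructive_indefinite_description _ (Hnext q))).
  assert (H0 : good ((a, b), (c, d))) by (split; [exact Hab | split; [exact Hcd | exact HN]]).
  set (s := fun n => Nat.iter n next (exist _ _ H0)).
  set (qs := fun n => proj1_sig (s n)).
  assert (Hg : forall n, good (qs n)) by (intros n; apply (proj2_sig (s n))).
  assert (HS : forall n, exists u v, qs (S n) = (half (fst (qs n)) u, half (snd (qs n)) v)).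
  { intros n. unfold qs at 1. simpl. unfold next at 1.
    destruct constructive_indefinite_description as [r Hr]. exact Hr. }
  assert (HW : forall n, snd (fst (qs n)) - fst (fst (qs n)) = (b - a) * (1 / 2) ^ n
    /\ snd (snd (qs n)) - fst (snd (qs n)) = (d - c) * (1 / 2) ^ n).
  { induction n as [|n IH]; [unfold qs; simpl; lra|].
    destruct (Hg n) as [G1 [G2 _]]. destruct (HS n) as [u [v E]]. rewrite E. simpl.
    destruct (Hhalf (fst (qs n)) u G1) as [_ [_ [_ E1]]].
    destruct (Hhalf (snd (qs n)) v G2) as [_ [_ [_ E2]]]. rewrite E1, E2. lra. }
  assert (Hm : forall n, fst (fst (qs n)) <= fst (fst (qs (S n)))
    /\ snd (fst (qs (S n))) <= snd (fst (qs n))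
    /\ fst (snd (qs n)) <= fst (snd (qs (S n))) /\ snd (snd (qs (S n))) <= snd (snd (qs n))).
  { intros n. destruct (Hg n) as [G1 [G2 _]]. destruct (HS n) as [u [v E]]. rewrite E.
    unfold fst at 3, snd at 1. cbv beta iota.
    repeat split; now apply Hhalf. }
  destruct (nested_intervals (fun n => fst (fst (qs n))) (fun n => snd (fst (qs n)))) as [x Hx];
    try (intros n; apply (Hm n)); try (intros n; apply (Hg n)).
  destruct (nested_intervals (fun n => fst (snd (qs n))) (fun n => snd (snd (qs n)))) as [y Hy];
    try (intros n; apply (Hm n)); try (intros n; apply (Hg n)).
  destruct (Hloc x y (Hx O) (Hy O)) as [delta [Hd K]].
  (* Once 2^-N is below this number, both sides of the N-th rectangle are shorter than delta; the 1
     covers degenerate rectangles. *)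
  assert (Hpos : 0 < delta / (1 + (b - a) + (d - c))) by (apply Rdiv_lt_0_compat; lra).
  destruct (pow_lt_1_zero (1 / 2) ltac:(rewrite Rabs_pos_eq; lra) _ Hpos) as [N HN'].
  specialize (HN' N (le_n N)).
  assert (Hp := pow_lt (1 / 2) N ltac:(lra)).
  rewrite Rabs_pos_eq in HN' by lra.
  apply (Rmult_lt_compat_r (1 + (b - a) + (d - c))) in HN'; [|lra].
  replace (delta / (1 + (b - a) + (d - c)) * (1 + (b - a) + (d - c))) with delta in HN' by (field; lra).
  destruct (HW N) as [W1 W2].
  apply (Hg N). apply K; [apply Hx | apply Hy | rewrite W1; nra | rewrite W2; nra].
Qed.

(** * Goursat's theorem and its consequences *)

Lemma between_le a b x : a <= b -> between a b x <-> a <= x <= b.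
Proof. intros H. now rewrite Rmin_left, Rmax_right. Qed.

Lemma between_swap a b x : between a b x <-> between b a x.
Proof. now rewrite Rmin_comm, Rmax_comm. Qed.

(** The bound by eps times the squared half-perimeter survives joining four quarters, because each
    has half the half-perimeter. Locally it holds because G is within eps/2 |w - p| of an affine
    function, whose integral vanishes since it has a primitive. *)
Lemma goursat_ordered G a b c d :
  a <= b -> c <= d ->
  (forall x y, a <= x <= b -> c <= y <= d -> exists l, cderiv G (x, y) l) ->
  rect G a b c d = 0%C.
Proof.
  intros Hab Hcd HD.
  assert (HC : forall x y, a <= x <= b -> c <= y <= d -> ccont G (x, y)).
  { intros x y Hx Hy. destruct (HD x y Hx Hy) as [l Hl]. now apply cderiv_ccont with l. }
  assert (Key : forall eps, 0 < eps -> Cmod (rect G a b c d) <= eps * ((b - a) + (d - c)) ^ 2).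
  { intros eps He.
    (* The bisected property includes containment in the original rectangle, the only place where G
       is known to be differentiable; these trivial premises put the goal in that form. *)
    assert (B : a <= a -> b <= b -> c <= c -> d <= d ->
      Cmod (rect G a b c d) <= eps * ((b - a) + (d - c)) ^ 2); [|apply B; lra].
    apply (rect_bisection (fun a' b' c' d' => a <= a' -> b' <= b -> c <= c' -> d' <= d ->
      Cmod (rect G a' b' c' d') <= eps * ((b' - a') + (d' - c')) ^ 2)); [exact Hab | exact Hcd | |].
    - intros a' b' c' d' H1 H2 Q1 Q2 Q3 Q4 L1 L2 L3 L4.
      set (m := (a' + b') / 2) in *. set (n := (c' + d') / 2) in *.
      assert (Hm : a' <= m <= b') by (unfold m; lra).
      assert (Hn : c' <= n <= d') by (unfold n; lra).
      assert (E : rect G a' b' c' d' =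
        ((rect G a' m c' n + rect G a' m n d') + (rect G m b' c' n + rect G m b' n d'))%C).
      { rewrite (rect_split_x G a' m b'), (rect_split_y G a' m c' n d'), (rect_split_y G m b' c' n d');
          try reflexivity; rewrite ?between_le by lra; try lra;
          intros u; rewrite between_le by lra; intros Hu; apply HC; lra. }
      rewrite E.
      eapply Rle_trans; [apply Cmod_triangle|].
      eapply Rle_trans; [apply Rplus_le_compat; apply Cmod_triangle|].
      specialize (Q1 ltac:(lra) ltac:(lra) ltac:(lra) ltac:(lra)).
      specialize (Q2 ltac:(lra) ltac:(lra) ltac:(lra) ltac:(lra)).
      specialize (Q3 ltac:(lra) ltac:(lra) ltac:(lra) ltac:(lra)).
      specialize (Q4 ltac:(lra) ltac:(lra) ltac:(lra) ltac:(lra)).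
      replace (m - a') with ((b' - a') / 2) in * by (unfold m; field).
      replace (b' - m) with ((b' - a') / 2) in * by (unfold m; field).
      replace (n - c') with ((d' - c') / 2) in * by (unfold n; field).
      replace (d' - n) with ((d' - c') / 2) in * by (unfold n; field).
      eapply Rle_trans; [apply Rplus_le_compat; apply Rplus_le_compat; eassumption|].
      right. field.
    - intros x y Hx Hy. destruct (HD x y Hx Hy) as [l Hl].
      (* With half-perimeter s the perimeter is 2s and the error at most eps/2 s, which gives eps
         s^2. Sides below d0/2 keep the rectangle inside the disc of radius d0. *)
      destruct (Hl (eps / 2)) as [d0 [D K]]; [lra|].
      exists (d0 / 2). split; [lra|].
      intros a' b' c' d' X Y W1 W2 L1 L2 L3 L4.
      set (A := fun w : C => (G (x, y) + (w - (x, y)) * l)%C).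
      assert (HA : forall w, cderiv A w l).
      { intros w. unfold A.
        apply cderiv_eq with (0 + ((1 - 0) * l + (w - (x, y)) * 0))%C; [|ring].
        apply cderiv_plus; [apply cderiv_const|].
        apply (cderiv_mult (fun w => w - (x, y))%C (fun _ => l)); [|apply cderiv_const].
        apply cderiv_minus; [apply cderiv_id | apply cderiv_const]. }
      set (F := fun w : C => (G (x, y) * w + RtoC (1 / 2) * l * ((w - (x, y)) * (w - (x, y))))%C).
      assert (HF : forall w, cderiv F w (A w)).
      { intros w. unfold F.
        assert (HI : cderiv (fun w => w - (x, y))%C w (1 - 0)%C)
          by (apply cderiv_minus; [apply cderiv_id | apply cderiv_const]).
        replace (A w) with (G (x, y) * 1 +
          RtoC (1 / 2) * l * ((1 - 0) * (w - (x, y)) + (w - (x, y)) * (1 - 0)))%C.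
        - apply cderiv_plus; apply cderiv_scal; [apply cderiv_id|].
          exact (cderiv_mult _ _ _ _ _ HI HI).
        - unfold A. replace (RtoC (1 / 2)) with (/ RtoC 2)%C by (rewrite <- RtoC_inv by lra; f_equal; lra).
          field. }
      assert (HR : rect A a' b' c' d' = 0%C).
      { apply (rect_primitive F).
        - intros u v _ _. apply cderiv_ccont with l, HA.
        - intros; apply HF. }
      assert (E : rect G a' b' c' d' = rect (fun w => G w - A w)%C a' b' c' d').
      { rewrite rect_minus.
        - rewrite HR. ring.
        - intros [u v] [U [V _]]. simpl in U, V. rewrite between_le in U, V by lra. apply HC; lra.
        - intros w _. apply cderiv_ccont with l, HA. }
      rewrite E.
      set (s := (b' - a') + (d' - c')).
      eapply Rle_trans.
      + apply (rect_bound _ _ _ _ _ (eps / 2 * s)).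
        * intros [u v] [U [V _]]. simpl in U, V. rewrite between_le in U, V by lra.
          destruct (HD u v ltac:(lra) ltac:(lra)) as [m Hm].
          apply (cderiv_ccont _ _ (m - l)%C). now apply cderiv_minus.
        * intros [u v] [U [V _]]. simpl in U, V. rewrite between_le in U, V by lra.
          assert (Bs : Cmod ((u, v) - (x, y))%C <= s).
          { eapply Rle_trans; [apply Cmod_pair|]. simpl. unfold s.
            apply Rplus_le_compat; apply Rabs_le; lra. }
          replace (G (u, v) - A (u, v))%C with (G (u, v) - G (x, y) - ((u, v) - (x, y)) * l)%C
            by (unfold A; ring).
          eapply Rle_trans; [apply K; unfold s in Bs; lra|].
          apply Rmult_le_compat_l; lra.
      + rewrite !Rabs_pos_eq by lra. fold s. right. simpl. field. }
  apply Cmod_eq_0.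
  destruct (Req_dec (Cmod (rect G a b c d)) 0) as [Z|Z]; [exact Z|exfalso].
  assert (P : 0 < Cmod (rect G a b c d)) by (generalize (Cmod_ge_0 (rect G a b c d)); lra).
  set (q := ((b - a) + (d - c)) ^ 2) in *.
  assert (Hq : 0 <= q) by apply pow2_ge_0.
  (* This eps makes the right side less than the integral itself; 1 + q guards against q = 0. *)
  specialize (Key (Cmod (rect G a b c d) / (2 * (1 + q)))).
  assert (H0 : 0 < Cmod (rect G a b c d) / (2 * (1 + q))) by (apply Rdiv_lt_0_compat; lra).
  specialize (Key H0).
  assert (E : Cmod (rect G a b c d) = Cmod (rect G a b c d) / (2 * (1 + q)) * (2 * (1 + q)))
    by (field; lra).
  rewrite E in Key at 1. nra.
Qed.

(** Reversing the ends of a side only changes the sign, so every orientation reduces to the ordered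
    case. *)
Lemma goursat G a b c d :
  (forall x y, between a b x -> between c d y -> exists l, cderiv G (x, y) l) ->
  rect G a b c d = 0%C.
Proof.
  intros HD.
  assert (HC : ccont_on G a b c d).
  { intros x y Hx Hy. destruct (HD x y Hx Hy) as [l Hl]. now apply cderiv_ccont with l. }
  assert (Hx : forall c d, c <= d ->
    (forall x y, between a b x -> c <= y <= d -> exists l, cderiv G (x, y) l) -> rect G a b c d = 0%C).
  { clear. intros c d Hcd HD. destruct (Rle_or_lt a b) as [H|H].
    - apply goursat_ordered; [exact H | exact Hcd |].
      intros x y X Y. apply HD; [now rewrite between_le | exact Y].
    - rewrite rect_swap_x.
      + rewrite goursat_ordered; [ring | lra | exact Hcd |].
        intros x y X Y. apply HD; [rewrite between_swap, between_le; lra | exact Y].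
      + intros x y X Y. destruct (HD x y) as [l Hl]; [now rewrite between_swap | now rewrite <- between_le |].
        now apply cderiv_ccont with l. }
  destruct (Rle_or_lt c d) as [H|H].
  - apply Hx; [exact H|]. intros x y X Y. apply HD; [exact X | now rewrite between_le].
  - rewrite rect_swap_y.
    + rewrite Hx; [ring | lra |]. intros x y X Y. apply HD; [exact X | rewrite between_swap, between_le; lra].
    + intros x y X Y. apply HC; [exact X | now rewrite between_swap].
Qed.

(* The exact value is [2 pi i]; a lower bound suffices for the derivative
   estimate and needs no antiderivative. *)
Lemma rect_inv_square (r : R) : 0 < r -> 4 <= Cmod (rect Cinv (- r) r (- r) r).
Proof.
  intros Hr.
  assert (HC : forall w : C, w <> 0%C -> ccont Cinv w)
    by (intros w Hw; eapply cderiv_ccont, cderiv_inv, Hw).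
  assert (N1 : forall s : R, ((s, r) : C) <> 0%C) by (intros s E; injection E; lra).
  assert (N2 : forall s : R, ((s, - r) : C) <> 0%C) by (intros s E; injection E; lra).
  assert (N3 : forall s : R, ((r, s) : C) <> 0%C) by (intros s E; injection E; lra).
  assert (N4 : forall s : R, ((- r, s) : C) <> 0%C) by (intros s E; injection E; lra).
  assert (I : is_CInt (fun s => Cinv (s, (- r)%R) + Ci * Cinv (r, s) - Cinv (s, r) - Ci * Cinv ((- r)%R, s))%C
    (- r) r (rect Cinv (- r) r (- r) r)).
  { unfold rect.
    assert (I1 : is_CInt (fun s => Cinv (s, (- r)%R)) (- r) r (hint Cinv (- r) (- r) r))
      by (apply (RInt_correct (V := C_R_CompleteNormedModule)), ex_hint; auto).
    assert (I2 : is_CInt (fun s => Cinv (s, r)) (- r) r (hint Cinv r (- r) r))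
      by (apply (RInt_correct (V := C_R_CompleteNormedModule)), ex_hint; auto).
    assert (I3 : is_CInt (fun s => Cinv (r, s)) (- r) r (vint Cinv r (- r) r))
      by (apply (RInt_correct (V := C_R_CompleteNormedModule)), ex_vint; auto).
    assert (I4 : is_CInt (fun s => Cinv ((- r)%R, s)) (- r) r (vint Cinv (- r) (- r) r))
      by (apply (RInt_correct (V := C_R_CompleteNormedModule)), ex_vint; auto).
    apply (is_CInt_Cmult Ci) in I3, I4.
    exact (is_RInt_minus _ _ _ _ _ _ (is_RInt_minus _ _ _ _ _ _ (is_RInt_plus _ _ _ _ _ _ I1 I3) I2) I4). }
  apply (is_RInt_fct_extend_snd (U := R_NormedModule) (V := R_NormedModule)) in I.
  eapply Rle_trans; [|apply Cmod_snd]. eapply Rle_trans; [|apply Rle_abs].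
  (* Each of the four sides has imaginary part r/(s^2 + r^2). As s^2 <= r^2, their sum is at least
     2/r, on an interval of length 2r. *)
  apply (is_RInt_le (fun _ => 2 / r) (fun s => snd (Cinv (s, (- r)%R) + Ci * Cinv (r, s) - Cinv (s, r) - Ci * Cinv ((- r)%R, s))%C) (- r) r).
  - lra.
  - replace 4 with (scal (r - - r) (2 / r)); [apply (is_RInt_const (V := R_NormedModule))|].
    unfold scal; simpl; unfold mult; simpl. field. lra.
  - exact I.
  - intros s Hs.
    replace (snd (Cinv (s, (- r)%R) + Ci * Cinv (r, s) - Cinv (s, r) - Ci * Cinv ((- r)%R, s))%C)
      with (4 * r / (s * s + r * r)).
    + assert (Hsr : 0 < s * s + r * r) by nra.
      apply (Rmult_le_reg_r (s * s + r * r)); [exact Hsr|].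
      replace (4 * r / (s * s + r * r) * (s * s + r * r)) with (4 * r) by (field; lra).
      apply (Rmult_le_reg_r r); [exact Hr|].
      replace (2 / r * (s * s + r * r) * r) with (2 * (s * s + r * r)) by (field; lra). nra.
    + unfold Cinv, Ci, Cminus, Cplus, Copp, Cmult; simpl. field.
      assert (0 < r * r + s * s) by nra. repeat split; nra.
Qed.

(* Goursat for [(f w - f 0 - l w) / w^2], whose singularity at [0] is
   [o(1 / |w|)], so that small squares around [0] contribute nothing. *)
Lemma cauchy_derivative_bound_0 f r M l :
  0 < r ->
  (forall w : C, Rabs (fst w) <= r -> Rabs (snd w) <= r -> exists m, cderiv f w m) ->
  (forall w : C, Rabs (fst w) <= r -> Rabs (snd w) <= r -> Cmod (f w) <= M) ->
  cderiv f 0 l -> Cmod l <= 4 * M / r.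
Proof.
  intros Hr HD HM Hl.
  set (G := fun w : C => ((f w - f 0 - l * w) * (/ w * / w))%C).
  assert (Hinv2 : forall w : C, w <> 0%C -> exists m, cderiv (fun w => / w * / w)%C w m)
    by (intros w Hw; eexists; apply cderiv_mult; apply cderiv_inv, Hw).
  assert (GD : forall w : C, Rabs (fst w) <= r -> Rabs (snd w) <= r -> w <> 0%C -> exists m, cderiv G w m).
  { intros w W1 W2 W0. destruct (HD w W1 W2) as [m Hm]. destruct (Hinv2 w W0) as [m' Hm'].
    eexists. apply cderiv_mult; [|exact Hm'].
    apply cderiv_minus; [apply cderiv_minus; [exact Hm | apply cderiv_const]|].
    apply cderiv_scal, cderiv_id. }
  assert (GC : forall w : C, Rabs (fst w) <= r -> Rabs (snd w) <= r -> w <> 0%C -> ccont G w).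
  { intros w W1 W2 W0. destruct (GD w W1 W2 W0) as [m Hm]. now apply cderiv_ccont with m. }
  assert (Hne1 : forall x y : R, x <> 0 -> ((x, y) : C) <> 0%C) by (intros x y H E; injection E; lra).
  assert (Hne2 : forall x y : R, y <> 0 -> ((x, y) : C) <> 0%C) by (intros x y H E; injection E; lra).
  (* The large square minus the small one splits into four rectangles avoiding 0, where Goursat
     applies. *)
  assert (Shrink : forall e, 0 < e < r -> rect G (- r) r (- r) r = rect G (- e) e (- e) e).
  { intros e He.
    rewrite (rect_split_x G (- r) (- e) r), (rect_split_x G (- e) e r),
      (rect_split_y G (- e) e (- r) (- e) r), (rect_split_y G (- e) e (- e) e r);
    try (rewrite between_le by lra; lra);
    try (intros u Hu; rewrite between_le in Hu by lra; apply GC;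
         [apply Rabs_le; simpl; lra | apply Rabs_le; simpl; lra |
          first [apply Hne1; lra | apply Hne2; lra]]).
    rewrite (goursat G (- r) (- e)), (goursat G e r), (goursat G (- e) e (- r) (- e)),
      (goursat G (- e) e e r); [ring | | | |];
    intros x y X Y; rewrite between_le in X, Y by lra; apply GD;
      try (apply Rabs_le; simpl; lra); first [apply Hne1; lra | apply Hne2; lra]. }
  assert (G0 : rect G (- r) r (- r) r = 0%C).
  { apply Cmod_eq_0.
    destruct (Req_dec (Cmod (rect G (- r) r (- r) r)) 0) as [Z|Z]; [exact Z|exfalso].
    assert (P : 0 < Cmod (rect G (- r) r (- r) r)) by (generalize (Cmod_ge_0 (rect G (- r) r (- r) r)); lra).
    set (q := Cmod (rect G (- r) r (- r) r)) in *.
    (* On the small boundary |w| >= e, so |G| <= q/(16e); the perimeter 8e gives q/2, less than q.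
       The condition e <= d/4 ensures |w| <= 2e < d. *)
    destruct (Hl (q / 16)) as [d [D K]]; [lra|].
    set (e := Rmin (r / 2) (d / 4)).
    assert (He : 0 < e) by (apply Rmin_glb_lt; lra).
    assert (He1 : e <= r / 2) by apply Rmin_l. assert (He2 : e <= d / 4) by apply Rmin_r.
    assert (B : q <= 2 * (q / 16 / e) * (Rabs (e - - e) + Rabs (e - - e))).
    { unfold q at 1. rewrite (Shrink e) by lra.
      assert (Hb : forall w, on_boundary (- e) e (- e) e w ->
        Rabs (fst w) <= e /\ Rabs (snd w) <= e /\ e <= Cmod w /\ w <> 0%C).
      { intros [x y] [X [Y HS]]. simpl in *. rewrite between_le in X, Y by lra.
        assert (Hw : e <= Cmod (x, y)).
        { assert (K1 := Cmod_fst (x, y)). assert (K2 := Cmod_snd (x, y)). simpl in K1, K2.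
          destruct HS as [HS|[HS|[HS|HS]]]; rewrite HS in *;
            [rewrite Rabs_Ropp in K1; rewrite Rabs_pos_eq in K1; lra
            |rewrite Rabs_pos_eq in K1; lra
            |rewrite Rabs_Ropp in K2; rewrite Rabs_pos_eq in K2; lra
            |rewrite Rabs_pos_eq in K2; lra]. }
        repeat split; try (apply Rabs_le; lra); [exact Hw|].
        apply Cmod_gt_0. lra. }
      apply rect_bound.
      - intros w Hw. destruct (Hb w Hw) as [X [Y [Z1 Z2]]]. apply GC; [lra | lra | exact Z2].
      - intros w Hw. destruct (Hb w Hw) as [X [Y [Z1 Z2]]]. unfold G.
        rewrite !Cmod_mult, !Cmod_inv by exact Z2.
        assert (Kw : Cmod (w - 0)%C < d).
        { replace (w - 0)%C with w by ring. destruct w as [x y]. simpl in X, Y.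
          eapply Rle_lt_trans; [apply Cmod_pair|]. lra. }
        specialize (K w Kw). replace (w - 0)%C with w in K by ring.
        replace (f w - f 0 - l * w)%C with (f w - f 0 - w * l)%C by ring.
        assert (Hi : / Cmod w <= / e) by (apply Rinv_le_contravar; lra).
        assert (Hip : 0 < / Cmod w) by (apply Rinv_0_lt_compat; lra).
        apply Rle_trans with (q / 16 * Cmod w * (/ Cmod w * / Cmod w)).
        + apply Rmult_le_compat_r; [nra | exact K].
        + replace (q / 16 * Cmod w * (/ Cmod w * / Cmod w)) with (q / 16 * / Cmod w) by (field; lra).
          unfold Rdiv at 2. apply Rmult_le_compat_l; lra. }
    rewrite Rabs_pos_eq in B by lra.
    replace (2 * (q / 16 / e) * (e - - e + (e - - e))) with (q / 2) in B by (field; lra). lra. }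
  (* Since G = A - B has integral 0, the integral of A is l times that of 1/w. As |A| <= 2M/r^2 on a
     perimeter of 8r, this gives 4|l| <= 16M/r. *)
  set (A := fun w : C => ((f w - f 0) * (/ w * / w))%C).
  set (B := fun w : C => (l * / w)%C).
  assert (Hb : forall w, on_boundary (- r) r (- r) r w ->
        Rabs (fst w) <= r /\ Rabs (snd w) <= r /\ r <= Cmod w /\ w <> 0%C).
  { intros [x y] [X [Y HS]]. simpl in *. rewrite between_le in X, Y by lra.
    assert (Hw : r <= Cmod (x, y)).
    { assert (K1 := Cmod_fst (x, y)). assert (K2 := Cmod_snd (x, y)). simpl in K1, K2.
      destruct HS as [HS|[HS|[HS|HS]]]; rewrite HS in *;
            [rewrite Rabs_Ropp in K1; rewrite Rabs_pos_eq in K1; lra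
            |rewrite Rabs_pos_eq in K1; lra
            |rewrite Rabs_Ropp in K2; rewrite Rabs_pos_eq in K2; lra
            |rewrite Rabs_pos_eq in K2; lra]. }
    repeat split; try (apply Rabs_le; lra); [exact Hw|].
    apply Cmod_gt_0. lra. }
  assert (CA : forall w, on_boundary (- r) r (- r) r w -> ccont A w).
  { intros w Hw. destruct (Hb w Hw) as [X [Y [_ Z]]].
    destruct (HD w X Y) as [m Hm]. destruct (Hinv2 w Z) as [m' Hm'].
    eapply cderiv_ccont, cderiv_mult; [|exact Hm'].
    apply cderiv_minus; [exact Hm | apply cderiv_const]. }
  assert (CI : forall w, on_boundary (- r) r (- r) r w -> ccont Cinv w).
  { intros w Hw. destruct (Hb w Hw) as [_ [_ [_ Z]]]. eapply cderiv_ccont, cderiv_inv, Z. }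
  assert (CB : forall w, on_boundary (- r) r (- r) r w -> ccont B w).
  { intros w Hw. destruct (Hb w Hw) as [_ [_ [_ Z]]]. eapply cderiv_ccont, cderiv_scal, cderiv_inv, Z. }
  assert (EG : rect G (- r) r (- r) r = rect (fun w => A w - B w)%C (- r) r (- r) r).
  { apply rect_ext. intros w Hw. unfold G, A, B. field. now apply Hb. }
  rewrite G0, rect_minus in EG by assumption.
  assert (EB : rect B (- r) r (- r) r = (l * rect Cinv (- r) r (- r) r)%C) by now apply rect_scal.
  assert (BA : Cmod (rect A (- r) r (- r) r) <= 2 * (2 * M / (r * r)) * (Rabs (r - - r) + Rabs (r - - r))).
  { apply rect_bound; [exact CA|].
    intros w Hw. destruct (Hb w Hw) as [X [Y [Z1 Z2]]]. unfold A.
    rewrite !Cmod_mult, !Cmod_inv by exact Z2.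
    assert (Hi : / Cmod w <= / r) by (apply Rinv_le_contravar; lra).
    assert (Hip : 0 < / Cmod w) by (apply Rinv_0_lt_compat; lra).
    assert (N : Cmod (f w - f 0)%C <= 2 * M).
    { eapply Rle_trans; [apply Cmod_minus_le|].
      assert (M1 := HM w X Y). assert (M2 : Cmod (f 0%C) <= M); [|lra].
      apply HM; simpl; rewrite Rabs_R0; lra. }
    replace (2 * M / (r * r)) with (2 * M * (/ r * / r)) by (field; lra).
    apply Rmult_le_compat; [apply Cmod_ge_0 | nra | exact N | nra]. }
  rewrite Rabs_pos_eq in BA by lra.
  assert (EAB : rect A (- r) r (- r) r = rect B (- r) r (- r) r).
  { replace (rect A (- r) r (- r) r) with
      ((rect A (- r) r (- r) r - rect B (- r) r (- r) r) + rect B (- r) r (- r) r)%C by ring.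
    rewrite <- EG. ring. }
  rewrite EAB, EB, Cmod_mult in BA.
  assert (R4 := rect_inv_square r Hr). assert (L := Cmod_ge_0 l).
  replace (2 * (2 * M / (r * r)) * (r - - r + (r - - r))) with (4 * (4 * M / r)) in BA by (field; lra).
  nra.
Qed.

Lemma cderiv_shift f (p z l : C) : cderiv f (z + p)%C l -> cderiv (fun w => f (w + p)%C) z l.
Proof.
  intros H eps He. destruct (H eps He) as [d [D K]]. exists d. split; [exact D|].
  intros w Hw. replace (w - z)%C with ((w + p) - (z + p))%C in * by ring. now apply K.
Qed.

(** The square of half-side r around p lies in the disc of radius 2r, where the hypotheses are
    made. *)
Lemma cauchy_derivative_bound f (p : C) r M l :
  0 < r ->
  (forall w, Cmod (w - p)%C <= 2 * r -> exists m, cderiv f w m) ->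
  (forall w, Cmod (w - p)%C <= 2 * r -> Cmod (f w) <= M) ->
  cderiv f p l -> Cmod l <= 4 * M / r.
Proof.
  intros Hr HD HM Hl.
  assert (Hb : forall w : C, Rabs (fst w) <= r -> Rabs (snd w) <= r -> Cmod (w + p - p)%C <= 2 * r).
  { intros w X Y. replace (w + p - p)%C with w by ring.
    destruct w as [x y]. simpl in X, Y. eapply Rle_trans; [apply Cmod_pair|]. lra. }
  apply (cauchy_derivative_bound_0 (fun w => f (w + p)%C) r M l Hr).
  - intros w X Y. destruct (HD (w + p)%C (Hb w X Y)) as [m Hm]. exists m. now apply cderiv_shift.
  - intros w X Y. now apply HM, Hb.
  - apply cderiv_shift. replace (0 + p)%C with p by ring. exact Hl.
Qed.

(** * Primitives on the unit disc *)

Lemma rect_degenerate_x G a c d : rect G a a c d = 0%C.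
Proof.
  unfold rect, hint. rewrite !(RInt_point (V := C_R_CompleteNormedModule)).
  change (zero (G := C_R_CompleteNormedModule)) with (RtoC 0). ring.
Qed.

Lemma rect_degenerate_y G a b c : rect G a b c c = 0%C.
Proof.
  unfold rect, vint. rewrite !(RInt_point (V := C_R_CompleteNormedModule)).
  change (zero (G := C_R_CompleteNormedModule)) with (RtoC 0). ring.
Qed.

Lemma between_0 x s : between 0 x s -> Rabs s <= Rabs x.
Proof. unfold Rmin, Rmax, Rabs. repeat destruct Rle_dec; repeat destruct Rcase_abs; lra. Qed.

(* At a corner, continuity is enough: the rectangle is cut into a small one
   at [0] and two rectangles avoiding [0]. *)
Lemma goursat_corner G x y :
  Cmod (x, y) < 1 ->
  (forall z, Cmod z < 1 -> ccont G z) ->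
  (forall z, Cmod z < 1 -> z <> 0%C -> exists l, cderiv G z l) ->
  rect G 0 x 0 y = 0%C.
Proof.
  intros Hxy HC HD.
  destruct (Req_dec x 0) as [->|X0]; [apply rect_degenerate_x|].
  destruct (Req_dec y 0) as [->|Y0]; [apply rect_degenerate_y|].
  assert (In : forall s t, between 0 x s -> between 0 y t -> Cmod (s, t) < 1).
  { intros s t Hs Ht. eapply Rle_lt_trans; [|exact Hxy].
    apply Cmod_box; simpl; now apply between_0. }
  assert (Bm : forall u e, 0 < e < 1 -> between 0 u (e * u)).
  { intros u e He. unfold Rmin, Rmax. destruct Rle_dec; nra. }
  assert (Shrink : forall e, 0 < e < 1 -> rect G 0 x 0 y = rect G 0 (e * x) 0 (e * y)).
  { intros e He.
    assert (BX := Bm x e He). assert (BY := Bm y e He).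
    assert (L0 := between_l 0 x). assert (L1 := between_r 0 x).
    assert (L2 := between_l 0 y). assert (L3 := between_r 0 y).
    rewrite (rect_split_x G 0 (e * x) x), (rect_split_y G 0 (e * x) 0 (e * y) y);
      try assumption; try (intros u Hu; apply HC, In; assumption).
    rewrite (goursat G 0 (e * x) (e * y) y), (goursat G (e * x) x 0 y); [ring | |];
    intros u v Hu Hv.
    - apply HD.
      + apply In; [|exact Hv]. apply between_sub with (e * x); [exact BX | now right].
      + intros E. injection E as E1 E2. rewrite E1 in Hu. revert Hu.
        unfold Rmin, Rmax. destruct Rle_dec; nra.
    - apply HD.
      + apply In.
        * apply between_sub with (e * x); [exact BX | now left].
        * apply between_sub with (e * y); [exact BY | now right].
      + intros E. injection E as E1 E2. rewrite E2 in Hv. revert Hv.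
        unfold Rmin, Rmax. destruct Rle_dec; nra. }
  apply Cmod_eq_0.
  destruct (Req_dec (Cmod (rect G 0 x 0 y)) 0) as [Z|Z]; [exact Z|exfalso].
  assert (P : 0 < Cmod (rect G 0 x 0 y)) by (generalize (Cmod_ge_0 (rect G 0 x 0 y)); lra).
  set (q := Cmod (rect G 0 x 0 y)) in *.
  destruct (HC 0%C ltac:(rewrite Cmod_0; lra) 1 Rlt_0_1) as [d [D K]].
  set (M := Cmod (G 0%C) + 1) in *.
  assert (HM : 0 < M) by (generalize (Cmod_ge_0 (G 0%C)); unfold M; lra).
  set (S := Rabs x + Rabs y).
  assert (HS : 0 < S) by (generalize (Rabs_pos_lt x X0) (Rabs_pos_lt y Y0); unfold S; lra).
  (* The three bounds give e < 1, then |G| <= M on the small rectangle, then an integral of at most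
     2MeS <= q/2. *)
  set (e := Rmin (1 / 2) (Rmin (d / (2 * S)) (q / (4 * M * S)))).
  assert (He : 0 < e).
  { assert (0 < M * S) by nra. repeat apply Rmin_glb_lt; try lra; apply Rdiv_lt_0_compat; lra. }
  assert (He1 : e <= 1 / 2) by apply Rmin_l.
  assert (He2 : e <= d / (2 * S)) by (eapply Rle_trans; [apply Rmin_r | apply Rmin_l]).
  assert (He3 : e <= q / (4 * M * S)) by (eapply Rle_trans; [apply Rmin_r | apply Rmin_r]).
  assert (B : q <= 2 * M * (Rabs (e * x - 0) + Rabs (e * y - 0))).
  { unfold q. rewrite (Shrink e) by lra. apply rect_bound.
    - intros [u v] [U [V _]]. simpl in U, V. apply HC, In.
      + apply between_sub with (e * x); [apply Bm; lra | now left].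
      + apply between_sub with (e * y); [apply Bm; lra | now left].
    - intros [u v] [U [V _]]. simpl in U, V. apply between_0 in U, V.
      rewrite Rabs_mult, (Rabs_pos_eq e) in U, V by lra.
      assert (Kd : Cmod ((u, v) - 0)%C < d).
      { rewrite Cminus_0_r. eapply Rle_lt_trans; [apply Cmod_pair|].
        apply (Rmult_le_compat_r S) in He2; [|lra].
        replace (d / (2 * S) * S) with (d / 2) in He2 by (field; lra). unfold S in He2. lra. }
      specialize (K _ Kd). generalize (Cmod_reverse (G (u, v)) (G 0%C)). unfold M. lra. }
  rewrite !Rminus_0_r, !Rabs_mult, (Rabs_pos_eq e) in B by lra.
  replace (2 * M * (e * Rabs x + e * Rabs y)) with (e * (2 * M * S)) in B by (unfold S; ring).
  apply (Rmult_le_compat_r (2 * M * S)) in He3; [|nra].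
  replace (q / (4 * M * S) * (2 * M * S)) with (q / 2) in He3 by (field; lra). lra.
Qed.

Lemma CInt_minus_const_bound (f : R -> C) (a b eps : R) (g : C) :
  ex_CInt f a b -> (forall x, between a b x -> Cmod (f x - g)%C <= eps) ->
  Cmod (CInt f a b - RtoC (b - a) * g)%C <= eps * Rabs (b - a).
Proof.
  intros H HB.
  assert (HI : is_CInt (fun x => f x - g)%C a b (CInt f a b - RtoC (b - a) * g)%C).
  { replace (RtoC (b - a) * g)%C with (scal (V := C_R_NormedModule) (b - a) g).
    - apply (is_RInt_minus (V := C_R_NormedModule)); [|apply (is_RInt_const (V := C_R_NormedModule))].
      now apply (RInt_correct (V := C_R_CompleteNormedModule)).
    - destruct g. unfold scal; simpl. unfold prod_scal, scal, Cmult, RtoC; simpl. unfold mult; simpl.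
      f_equal; ring. }
  assert (E := is_RInt_unique (V := C_R_CompleteNormedModule) _ _ _ _ HI). rewrite <- E.
  apply CInt_bound; [eexists; exact HI | exact HB].
Qed.

(** The primitive integrates G along the real axis and then vertically. Vanishing over rectangles
    with a corner at 0 permits the other order of sides, so the increment from (x, y) to (x', y')
    reduces to one horizontal and one vertical segment near (x, y), where G is almost constant. *)
Lemma disc_primitive G :
  (forall z, Cmod z < 1 -> ccont G z) ->
  (forall z, Cmod z < 1 -> z <> 0%C -> exists l, cderiv G z l) ->
  exists P, forall z, Cmod z < 1 -> cderiv P z (G z).
Proof.
  intros HC HD.
  exists (fun z => hint G 0 0 (fst z) + Ci * vint G (fst z) 0 (snd z))%C.
  intros [x y] Hz eps He.
  destruct (HC (x, y) Hz (eps / 2)) as [d0 [D0 K]]; [lra|].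
  exists (Rmin d0 (1 - Cmod (x, y))). split; [apply Rmin_glb_lt; lra|].
  intros [x' y'] Hw. simpl fst. simpl snd.
  assert (Hw1 := Rlt_le_trans _ _ _ Hw (Rmin_l _ _)).
  assert (Hw2 := Rlt_le_trans _ _ _ Hw (Rmin_r _ _)).
  assert (A1 := Cmod_fst ((x', y') - (x, y))%C). assert (A2 := Cmod_snd ((x', y') - (x, y))%C).
  simpl in A1, A2. fold (x' - x) in A1. fold (y' - y) in A2.
  assert (Near : forall s t, between x x' s -> between y y' t ->
    Cmod ((s, t) - (x, y))%C <= Cmod ((x', y') - (x, y))%C).
  { intros s t Hs Ht. apply Cmod_box; simpl.
    - revert Hs. unfold Rmin, Rmax, Rabs. repeat destruct Rle_dec; repeat destruct Rcase_abs; lra.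
    - revert Ht. unfold Rmin, Rmax, Rabs. repeat destruct Rle_dec; repeat destruct Rcase_abs; lra. }
  assert (NearD : forall s t, between x x' s -> between y y' t -> Cmod (s, t) < 1).
  { intros s t Hs Ht. generalize (Near s t Hs Ht) (Cmod_reverse (s, t) (x, y)). lra. }
  assert (NearE : forall s t, between x x' s -> between y y' t -> Cmod (G (s, t) - G (x, y))%C <= eps / 2).
  { intros s t Hs Ht. apply Rlt_le, K. eapply Rle_lt_trans; [now apply Near | exact Hw1]. }
  (* Used at s = x and s = x', both at height y: the vertical integral over the imaginary axis then
     cancels in the difference. *)
  assert (Swap : forall s, Cmod (s, y) < 1 ->
    (hint G 0 0 s + Ci * vint G s 0 y = Ci * vint G 0 0 y + hint G y 0 s)%C).
  { intros s Hs. assert (E := goursat_corner G s y Hs HC HD). unfold rect in E.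
    replace (hint G 0 0 s + Ci * vint G s 0 y)%C with
      ((hint G 0 0 s + Ci * vint G s 0 y - hint G y 0 s - Ci * vint G 0 0 y)
        + (Ci * vint G 0 0 y + hint G y 0 s))%C by ring.
    rewrite E. ring. }
  assert (Box : forall s t u v, Cmod (u, v) < 1 -> Rabs s <= Rabs u -> Rabs t <= Rabs v -> ccont G (s, t)).
  { intros s t u v Hu S T. apply HC. eapply Rle_lt_trans; [|exact Hu]. now apply Cmod_box. }
  assert (Bx := between_l x x'). assert (Bx' := between_r x x').
  assert (By := between_l y y'). assert (By' := between_r y y').
  assert (E2 : vint G x' 0 y' = (vint G x' 0 y + vint G x' y y')%C).
  { apply vint_Chasles. intros t [Ht|Ht].
    - apply (Box x' t x' y); [now apply NearD | lra | now apply between_0].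
    - apply HC. now apply NearD. }
  assert (E1 : hint G y 0 x' = (hint G y 0 x + hint G y x x')%C).
  { apply hint_Chasles. intros s [Hs|Hs].
    - apply (Box s y x y); [now apply NearD | now apply between_0 | lra].
    - apply HC. now apply NearD. }
  rewrite E2.
  replace (hint G 0 0 x' + Ci * (vint G x' 0 y + vint G x' y y') - (hint G 0 0 x + Ci * vint G x 0 y) -
      ((x', y') - (x, y)) * G (x, y))%C with
    ((hint G 0 0 x' + Ci * vint G x' 0 y) - (hint G 0 0 x + Ci * vint G x 0 y)
      + Ci * vint G x' y y' - ((x', y') - (x, y)) * G (x, y))%C by ring.
  rewrite !Swap by now apply NearD. rewrite E1.
  replace ((x', y') - (x, y))%C with (RtoC (x' - x) + Ci * RtoC (y' - y))%C at 1
    by (unfold Cminus, Cplus, Copp, Cmult, Ci, RtoC; simpl; f_equal; ring).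
  replace (Ci * vint G 0 0 y + (hint G y 0 x + hint G y x x') - (Ci * vint G 0 0 y + hint G y 0 x) +
      Ci * vint G x' y y' - (RtoC (x' - x) + Ci * RtoC (y' - y)) * G (x, y))%C with
    ((hint G y x x' - RtoC (x' - x) * G (x, y)) +
      Ci * (vint G x' y y' - RtoC (y' - y) * G (x, y)))%C by ring.
  eapply Rle_trans; [apply Cmod_triangle|]. rewrite Cmod_mult, Cmod_Ci.
  assert (F1 : Cmod (hint G y x x' - RtoC (x' - x) * G (x, y))%C <= eps / 2 * Rabs (x' - x)).
  { apply CInt_minus_const_bound; [apply ex_hint|]; intros; [apply HC, NearD | apply NearE]; assumption. }
  assert (F2 : Cmod (vint G x' y y' - RtoC (y' - y) * G (x, y))%C <= eps / 2 * Rabs (y' - y)).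
  { apply CInt_minus_const_bound; [apply ex_vint|]; intros; [apply HC, NearD | apply NearE]; assumption. }
  nra.
Qed.

(** * The Bloch seminorm *)

Definition weight (alpha : R) (z : C) : R := Rpower (1 - Cmod z ^ 2) alpha.

(** A real bound in place of the extended-real supremum. It is vacuous where f has no derivative, so
    estimates drawn from it also assume [holo_on_D]. *)
Definition bloch_le (alpha : R) (f : C -> C) (N : R) : Prop :=
  forall z l, Cmod z < 1 -> cderiv f z l -> weight alpha z * Cmod l <= N.

Lemma weight_pos alpha z : 0 < weight alpha z.
Proof. apply exp_pos. Qed.

Lemma disc_sq z : Cmod z < 1 -> 0 < 1 - Cmod z ^ 2 <= 1.
Proof. intros H. assert (P := Cmod_ge_0 z). simpl. nra. Qed.

Lemma weight_antitone alpha z w :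
  0 < alpha -> Cmod w <= Cmod z -> Cmod z < 1 -> weight alpha z <= weight alpha w.
Proof.
  intros Ha Hwz Hz. unfold weight. apply Rle_Rpower_l; [lra|]. split; [now apply disc_sq|].
  assert (P := Cmod_ge_0 w). simpl. nra.
Qed.

Lemma weight_0 alpha : weight alpha 0%C = 1.
Proof. unfold weight. rewrite Cmod_0. replace (1 - 0 ^ 2) with 1 by ring. unfold Rpower. now rewrite ln_1, Rmult_0_r, exp_0. Qed.

Lemma weight_le_1 alpha z : 0 < alpha -> Cmod z < 1 -> weight alpha z <= 1.
Proof.
  intros Ha Hz. rewrite <- (weight_0 alpha). apply weight_antitone; [exact Ha | | exact Hz].
  rewrite Cmod_0. apply Cmod_ge_0.
Qed.

Lemma holo_cderiv f : holo_on_D f <-> forall z, Cmod z < 1 -> exists l, cderiv f z l.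
Proof.
  split; intros H z Hz; destruct (H z Hz) as [l Hl]; exists l; now apply is_derive_cderiv.
Qed.

Lemma bloch_norm_le alpha f N :
  holo_on_D f -> bloch_le alpha f N ->
  exists r, bloch_norm alpha f = Finite r /\ 0 <= r <= N.
Proof.
  intros Hf HN.
  destruct (Lub_Rbar_correct (bloch_set alpha f)) as [U L]. fold (bloch_norm alpha f) in U, L.
  assert (L' : Rbar_le (bloch_norm alpha f) (Finite N)).
  { apply L. intros r [z [l [Hz [Hl ->]]]]. apply (HN z l Hz). now apply is_derive_cderiv. }
  (* The supremum of an empty set would be minus infinity; the derivative at 0 supplies a
     nonnegative element. *)
  assert (D0 : inDisc 0%C) by (unfold inDisc; rewrite Cmod_0; lra).
  destruct (Hf 0%C D0) as [l Hl].
  assert (U0 : Rbar_le (Finite (Rpower (1 - Cmod 0 ^ 2) alpha * Cmod l)) (bloch_norm alpha f))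
    by (apply U; exists 0%C, l; split; [assumption | split; [assumption | reflexivity]]).
  assert (P : 0 <= Rpower (1 - Cmod 0 ^ 2) alpha * Cmod l)
    by (apply Rmult_le_pos; [apply Rlt_le, exp_pos | apply Cmod_ge_0]).
  destruct (bloch_norm alpha f) as [r| |]; simpl in *; try contradiction.
  exists r. split; [reflexivity | lra].
Qed.

Lemma bloch_norm_bloch_le alpha f r :
  Rbar_le (bloch_norm alpha f) (Finite r) -> bloch_le alpha f r.
Proof.
  intros H z l Hz Hl.
  destruct (Lub_Rbar_correct (bloch_set alpha f)) as [U _]. fold (bloch_norm alpha f) in U.
  apply (Rbar_le_trans (Finite (weight alpha z * Cmod l)) (bloch_norm alpha f) (Finite r)); [|exact H].
  apply U. exists z, l. apply is_derive_cderiv in Hl. split; [assumption | split; [assumption | reflexivity]].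
Qed.

Lemma inB0_intro alpha (f : C -> C) N :
  (forall z, ~ Cmod z < 1 -> f z = 0%C) -> holo_on_D f -> f 0%C = 0%C -> bloch_le alpha f N ->
  inB0 alpha f.
Proof.
  intros H1 H2 H3 H4. split; [exact H1|]. split; [exact H2|]. split; [exact H3|].
  destruct (bloch_norm_le _ _ _ H2 H4) as [r [-> _]]. reflexivity.
Qed.

Lemma inB0_bloch_le alpha f : inB0 alpha f -> exists N, 0 <= N /\ bloch_le alpha f N.
Proof.
  intros [_ [H2 [_ H4]]].
  assert (B : bloch_le alpha f (real (bloch_norm alpha f))).
  { apply bloch_norm_bloch_le. rewrite H4. apply Rbar_le_refl. }
  exists (real (bloch_norm alpha f)). split; [|exact B].
  destruct (bloch_norm_le _ _ _ H2 B) as [r [-> H]]. simpl. lra.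
Qed.

Lemma bloch_le_plus alpha f g N M :
  holo_on_D f -> holo_on_D g -> bloch_le alpha f N -> bloch_le alpha g M ->
  bloch_le alpha (fun z => f z + g z)%C (N + M).
Proof.
  intros Hf Hg HN HM z l Hz Hl.
  destruct (proj1 (holo_cderiv f) Hf z Hz) as [m Hm].
  destruct (proj1 (holo_cderiv g) Hg z Hz) as [n Hn].
  rewrite (cderiv_unique _ _ _ _ Hl (cderiv_plus _ _ _ _ _ Hm Hn)).
  specialize (HN z m Hz Hm). specialize (HM z n Hz Hn).
  assert (P := weight_pos alpha z). assert (T := Cmod_triangle m n). nra.
Qed.

Lemma bloch_le_scal alpha c f N :
  holo_on_D f -> bloch_le alpha f N -> bloch_le alpha (fun z => c * f z)%C (Cmod c * N).
Proof.
  intros Hf HN z l Hz Hl.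
  destruct (proj1 (holo_cderiv f) Hf z Hz) as [m Hm].
  rewrite (cderiv_unique _ _ _ _ Hl (cderiv_scal c _ _ _ Hm)), Cmod_mult.
  specialize (HN z m Hz Hm). assert (P := Cmod_ge_0 c). nra.
Qed.

Lemma holo_plus f g : holo_on_D f -> holo_on_D g -> holo_on_D (fun z => f z + g z)%C.
Proof.
  rewrite !holo_cderiv. intros Hf Hg z Hz.
  destruct (Hf z Hz) as [m Hm]. destruct (Hg z Hz) as [n Hn].
  eexists. exact (cderiv_plus _ _ _ _ _ Hm Hn).
Qed.

Lemma holo_scal c f : holo_on_D f -> holo_on_D (fun z => c * f z)%C.
Proof.
  rewrite !holo_cderiv. intros Hf z Hz. destruct (Hf z Hz) as [m Hm].
  eexists. exact (cderiv_scal _ _ _ _ Hm).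
Qed.

Lemma inB0_plus alpha f g : inB0 alpha f -> inB0 alpha g -> inB0 alpha (fun z => f z + g z)%C.
Proof.
  intros Hf Hg.
  destruct (inB0_bloch_le _ _ Hf) as [N [_ HN]]. destruct (inB0_bloch_le _ _ Hg) as [M [_ HM]].
  destruct Hf as [F1 [F2 [F3 _]]]. destruct Hg as [G1 [G2 [G3 _]]].
  apply inB0_intro with (N + M).
  - intros z Hz. rewrite F1, G1 by exact Hz. ring.
  - now apply holo_plus.
  - rewrite F3, G3. ring.
  - now apply bloch_le_plus.
Qed.

Lemma inB0_scal alpha c f : inB0 alpha f -> inB0 alpha (fun z => c * f z)%C.
Proof.
  intros Hf. destruct (inB0_bloch_le _ _ Hf) as [N [_ HN]]. destruct Hf as [F1 [F2 [F3 _]]].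
  apply inB0_intro with (Cmod c * N).
  - intros z Hz. rewrite F1 by exact Hz. ring.
  - now apply holo_scal.
  - rewrite F3. ring.
  - now apply bloch_le_scal.
Qed.

Lemma bloch_le_minus alpha f g N M :
  holo_on_D f -> holo_on_D g -> bloch_le alpha f N -> bloch_le alpha g M ->
  bloch_le alpha (fun z => f z - g z)%C (N + M).
Proof.
  intros Hf Hg HN HM z l Hz Hl.
  destruct (proj1 (holo_cderiv f) Hf z Hz) as [m Hm].
  destruct (proj1 (holo_cderiv g) Hg z Hz) as [n Hn].
  rewrite (cderiv_unique _ _ _ _ Hl (cderiv_minus _ _ _ _ _ Hm Hn)).
  specialize (HN z m Hz Hm). specialize (HM z n Hz Hn).
  assert (P := weight_pos alpha z). assert (T := Cmod_minus_le m n). nra.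
Qed.

Lemma holo_minus f g : holo_on_D f -> holo_on_D g -> holo_on_D (fun z => f z - g z)%C.
Proof.
  rewrite !holo_cderiv. intros Hf Hg z Hz.
  destruct (Hf z Hz) as [m Hm]. destruct (Hg z Hz) as [n Hn].
  eexists. exact (cderiv_minus _ _ _ _ _ Hm Hn).
Qed.

Lemma segment_convex (z w : C) t r :
  0 <= t <= 1 -> Cmod z <= r -> Cmod w <= r -> Cmod (z + RtoC t * (w - z))%C <= r.
Proof.
  intros Ht Hz Hw.
  replace (z + RtoC t * (w - z))%C with (RtoC (1 - t) * z + RtoC t * w)%C
    by (rewrite RtoC_minus; ring).
  eapply Rle_trans; [apply Cmod_triangle|].
  rewrite !Cmod_mult, !Cmod_R, !Rabs_pos_eq by lra. nra.
Qed.

(** The weight decreases with the modulus, so |f'| <= N / [weight alpha b] on the closed disc of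
    radius |b|. That disc is convex and contains the segment from z to w. *)
Lemma bloch_lipschitz alpha f N (z w b : C) :
  0 < alpha -> holo_on_D f -> bloch_le alpha f N ->
  Cmod z <= Cmod b -> Cmod w <= Cmod b -> Cmod b < 1 ->
  Cmod (f w - f z)%C <= N / weight alpha b * Cmod (w - z)%C.
Proof.
  intros Ha Hf HN Hz Hw Hb. apply cderiv_mean_value. intros t Ht.
  assert (Hs := segment_convex z w t _ Ht Hz Hw).
  destruct (proj1 (holo_cderiv f) Hf (z + RtoC t * (w - z))%C) as [l Hl]; [lra|].
  exists l. split; [exact Hl|].
  assert (P := weight_pos alpha b).
  assert (W := weight_antitone alpha b _ Ha Hs Hb).
  assert (B := HN _ l (Rle_lt_trans _ _ _ Hs Hb) Hl). assert (L := Cmod_ge_0 l).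
  apply (Rmult_le_reg_r (weight alpha b)); [exact P|].
  unfold Rdiv. rewrite Rmult_assoc, Rinv_l by lra. nra.
Qed.

Lemma bloch_growth alpha (f : C -> C) N z :
  0 < alpha -> holo_on_D f -> f 0%C = 0%C -> bloch_le alpha f N -> Cmod z < 1 ->
  Cmod (f z) <= N / weight alpha z * Cmod z.
Proof.
  intros Ha Hf F0 HN Hz.
  assert (B := bloch_lipschitz alpha f N 0%C z z Ha Hf HN).
  rewrite F0, !Cminus_0_r, Cmod_0 in B. apply B; [apply Cmod_ge_0 | lra | exact Hz].
Qed.

(** * The Alexander operator *)

(* The analytic function [f z / z], where [l] stands for [f' 0]. *)
Definition quot (f : C -> C) (l : C) (z : C) : C :=
  if excluded_middle_informative (z = 0%C) then l else (f z / z)%C.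

Lemma quot_0 f l : quot f l 0%C = l.
Proof. unfold quot. now destruct excluded_middle_informative. Qed.

Lemma quot_neq_0 f l (z : C) : z <> 0%C -> quot f l z = (f z / z)%C.
Proof. intros H. unfold quot. now destruct excluded_middle_informative. Qed.

Lemma quot_minus f g l m z : quot (fun w => f w - g w)%C (l - m)%C z = (quot f l z - quot g m z)%C.
Proof. unfold quot. destruct excluded_middle_informative; [reflexivity|]. unfold Cdiv. ring. Qed.

(** Continuity is all that [disc_primitive] asks for at 0, and it is a restatement of
    differentiability of f there. *)
Lemma ccont_quot_0 (f : C -> C) l : f 0%C = 0%C -> cderiv f 0 l -> ccont (quot f l) 0.
Proof.
  intros F0 Hl eps He. destruct (Hl (eps / 2)) as [d [D K]]; [lra|].
  exists d. split; [exact D|]. intros w Hw. rewrite quot_0.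
  destruct (excluded_middle_informative (w = 0%C)) as [->|W].
  - rewrite quot_0. replace (l - l)%C with (RtoC 0) by ring. now rewrite Cmod_0.
  - rewrite quot_neq_0 by exact W. specialize (K w Hw).
    rewrite F0, !Cminus_0_r in K.
    assert (P : 0 < Cmod w) by now apply Cmod_gt_0.
    apply Rle_lt_trans with (eps / 2); [|lra].
    apply (Rmult_le_reg_r (Cmod w)); [exact P|].
    rewrite <- Cmod_mult. replace ((f w / w - l) * w)%C with (f w - w * l)%C by (field; exact W).
    exact K.
Qed.

Lemma ex_cderiv_quot (f : C -> C) l (z : C) m : z <> 0%C -> cderiv f z m -> exists k, cderiv (quot f l) z k.
Proof.
  intros Hz Hm. eexists. eapply cderiv_ext_loc; [|exact (cderiv_mult _ _ _ _ _ Hm (cderiv_inv z Hz))].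
  exists (Cmod z). split; [now apply Cmod_gt_0|]. intros w Hw.
  rewrite quot_neq_0; [reflexivity|]. intros ->.
  revert Hw. replace (0 - z)%C with (- z)%C by ring. rewrite Cmod_opp. lra.
Qed.

(** The factor |z| in [bloch_growth] cancels the denominator, so f(z)/z obeys the same weighted
    bound as f'. Boundedness of the operator follows on multiplying by a bound of g0. *)
Lemma quot_bound alpha (f : C -> C) l N z :
  0 < alpha -> holo_on_D f -> f 0%C = 0%C -> cderiv f 0 l -> bloch_le alpha f N -> Cmod z < 1 ->
  weight alpha z * Cmod (quot f l z) <= N.
Proof.
  intros Ha Hf F0 Hl HN Hz.
  destruct (excluded_middle_informative (z = 0%C)) as [->|Z].
  - rewrite quot_0. now apply HN.
  - rewrite quot_neq_0, Cmod_div by exact Z.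
    assert (P : 0 < Cmod z) by now apply Cmod_gt_0.
    assert (W := weight_pos alpha z). assert (B := bloch_growth alpha f N z Ha Hf F0 HN Hz).
    apply (Rmult_le_reg_r (Cmod z)); [exact P|].
    replace (weight alpha z * (Cmod (f z) / Cmod z) * Cmod z) with (weight alpha z * Cmod (f z))
      by (field; lra).
    apply (Rmult_le_compat_l (weight alpha z)) in B; [|lra].
    replace (weight alpha z * (N / weight alpha z * Cmod z)) with (N * Cmod z) in B by (field; lra).
    exact B.
Qed.

Definition alexander_integrand (g0 f : C -> C) (z : C) (t : R) : C :=
  (f (RtoC t * z) * g0 (RtoC t * z) / (RtoC t * z) * z)%C.

Lemma alexander_primitive g0 (f : C -> C) l :
  holo_on_D g0 -> holo_on_D f -> f 0%C = 0%C -> cderiv f 0 l ->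
  exists P, (forall z, Cmod z < 1 -> cderiv P z (quot f l z * g0 z)%C) /\
    forall z, Cmod z < 1 -> is_CInt (alexander_integrand g0 f z) 0 1 (P z - P 0)%C.
Proof.
  rewrite !holo_cderiv. intros Hg Hf F0 Hl.
  set (G := fun z => (quot f l z * g0 z)%C).
  assert (Hgc : forall z, Cmod z < 1 -> ccont g0 z)
    by (intros z Hz; destruct (Hg z Hz) as [m Hm]; now apply cderiv_ccont with m).
  assert (GC : forall z, Cmod z < 1 -> ccont G z).
  { intros z Hz. apply ccont_mult; [|now apply Hgc].
    destruct (excluded_middle_informative (z = 0%C)) as [->|Z]; [now apply ccont_quot_0|].
    destruct (Hf z Hz) as [m Hm]. destruct (ex_cderiv_quot f l z m Z Hm) as [k Hk].
    now apply cderiv_ccont with k. }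
  assert (GD : forall z, Cmod z < 1 -> z <> 0%C -> exists k, cderiv G z k).
  { intros z Hz Z. destruct (Hf z Hz) as [m Hm]. destruct (Hg z Hz) as [n Hn].
    destruct (ex_cderiv_quot f l z m Z Hm) as [k Hk]. eexists. exact (cderiv_mult _ _ _ _ _ Hk Hn). }
  destruct (disc_primitive G GC GD) as [P HP].
  exists P. split; [exact HP|]. intros z Hz.
  assert (In : forall t, 0 <= t <= 1 -> Cmod (0 + RtoC t * z)%C < 1).
  { intros t Ht. replace (0 + RtoC t * z)%C with (RtoC t * z)%C by ring.
    rewrite Cmod_mult, Cmod_R, Rabs_pos_eq by lra. assert (Z := Cmod_ge_0 z). nra. }
  (* The integrands need to agree only for 0 < t < 1, so the division by 0 at t = 0 does not
     matter. *)
  apply (is_RInt_ext (V := C_R_NormedModule) (fun t => z * G (0 + RtoC t * z))%C).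
  - intros t. rewrite Rmin_left, Rmax_right by lra. intros Ht. unfold alexander_integrand, G.
    replace (0 + RtoC t * z)%C with (RtoC t * z)%C by ring.
    match goal with |- ?x = ?y => change (@eq C x y) end.
    destruct (excluded_middle_informative (z = 0%C)) as [->|Z]; [ring|].
    rewrite quot_neq_0; [unfold Cdiv; ring|].
    apply Cmult_neq_0; [|exact Z]. intros E. injection E. lra.
  - replace (P z - P 0)%C with
      (minus (G := C_R_NormedModule) (P (0 + RtoC 1 * z)%C) (P (0 + RtoC 0 * z)%C)).
    + apply (is_RInt_derive (V := C_R_CompleteNormedModule) (fun t => P (0 + RtoC t * z)%C));
        intros t; rewrite Rmin_left, Rmax_right by lra; intros Ht.
      * apply (is_derive_along P 0%C z). apply HP, In, Ht.
      * apply (continuous_ccont (fun w => z * G w)%C (fun t => 0 + RtoC t * z)%C).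
        -- apply ccont_mult; [apply (cderiv_ccont _ _ 0%C), cderiv_const | now apply GC, In].
        -- apply (ex_derive_continuous (V := C_R_NormedModule)).
           exists (z * 1)%C. apply (is_derive_along (fun w => w) 0%C z), cderiv_id.
    + change (P (0 + RtoC 1 * z) - P (0 + RtoC 0 * z) = P z - P 0)%C.
      replace (0 + RtoC 1 * z)%C with z by ring. replace (0 + RtoC 0 * z)%C with (RtoC 0) by ring.
      reflexivity.
Qed.

Lemma alexander_in g0 f z : Cmod z < 1 -> alexander_op g0 f z = CInt (alexander_integrand g0 f z) 0 1.
Proof. intros Hz. unfold alexander_op. now destruct Rlt_dec. Qed.

Lemma alexander_out g0 f z : ~ Cmod z < 1 -> alexander_op g0 f z = 0%C.
Proof. intros Hz. unfold alexander_op. now destruct Rlt_dec. Qed.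

Lemma alexander_cderiv g0 (f : C -> C) l z :
  holo_on_D g0 -> holo_on_D f -> f 0%C = 0%C -> cderiv f 0 l -> Cmod z < 1 ->
  cderiv (alexander_op g0 f) z (quot f l z * g0 z)%C.
Proof.
  intros Hg Hf F0 Hl Hz.
  destruct (alexander_primitive g0 f l Hg Hf F0 Hl) as [P [HP HI]].
  apply (cderiv_ext_loc (fun w => P w - P 0)%C).
  (* This ball stays in the disc, where the operator is the integral and not its default value 0. *)
  - exists (1 - Cmod z). split; [lra|]. intros w Hw.
    assert (W : Cmod w < 1) by (generalize (Cmod_reverse w z); lra).
    rewrite alexander_in by exact W. symmetry.
    apply (is_RInt_unique (V := C_R_CompleteNormedModule)). now apply HI.
  - apply cderiv_eq with (quot f l z * g0 z - 0)%C; [|ring].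
    apply cderiv_minus; [now apply HP | apply cderiv_const].
Qed.

Lemma disc_0 : Cmod 0%C < 1.
Proof. rewrite Cmod_0. lra. Qed.

Lemma alexander_ex_integral alpha g0 f z :
  holo_on_D g0 -> inB0 alpha f -> Cmod z < 1 -> ex_CInt (alexander_integrand g0 f z) 0 1.
Proof.
  intros Hg [_ [Hf [F0 _]]] Hz. destruct (proj1 (holo_cderiv f) Hf 0%C disc_0) as [l Hl].
  destruct (alexander_primitive g0 f l Hg Hf F0 Hl) as [P [_ HI]]. eexists. now apply HI.
Qed.

Lemma alexander_holo alpha g0 f : holo_on_D g0 -> inB0 alpha f -> holo_on_D (alexander_op g0 f).
Proof.
  intros Hg [_ [Hf [F0 _]]]. destruct (proj1 (holo_cderiv f) Hf 0%C disc_0) as [l Hl].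
  apply holo_cderiv. intros z Hz. eexists. now apply (alexander_cderiv g0 f l).
Qed.

Lemma alexander_inB0 alpha g0 f M :
  0 < alpha -> holo_on_D g0 -> (forall z, Cmod z < 1 -> Cmod (g0 z) <= M) ->
  inB0 alpha f -> inB0 alpha (alexander_op g0 f).
Proof.
  intros Ha Hg HM Hf. assert (HT := alexander_holo alpha g0 f Hg Hf).
  destruct (inB0_bloch_le _ _ Hf) as [N [N0 HN]].
  destruct Hf as [_ [Hf [F0 _]]]. destruct (proj1 (holo_cderiv f) Hf 0%C disc_0) as [l Hl].
  apply inB0_intro with (N * M).
  - intros z Hz. now apply alexander_out.
  - exact HT.
  - rewrite alexander_in by exact disc_0.
    transitivity (CInt (fun _ => RtoC 0) 0 1).
    + apply (RInt_ext (V := C_R_CompleteNormedModule)). intros t _. unfold alexander_integrand.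
      match goal with |- ?x = ?y => change (@eq C x y) end.
      replace (RtoC t * 0)%C with (RtoC 0) by ring. rewrite F0. unfold Cdiv. ring.
    + rewrite (RInt_const (V := C_R_CompleteNormedModule)).
      apply (scal_zero_r (V := C_R_NormedModule)).
  - intros z k Hz Hk.
    rewrite (cderiv_unique _ _ _ _ Hk (alexander_cderiv g0 f l z Hg Hf F0 Hl Hz)), Cmod_mult.
    rewrite <- Rmult_assoc. apply Rmult_le_compat; try apply Cmod_ge_0.
    + apply Rmult_le_pos; [apply Rlt_le, weight_pos | apply Cmod_ge_0].
    + now apply quot_bound.
    + now apply HM.
Qed.

Lemma alexander_plus alpha g0 f g :
  holo_on_D g0 -> inB0 alpha f -> inB0 alpha g ->
  alexander_op g0 (fun z => f z + g z)%C = (fun z => alexander_op g0 f z + alexander_op g0 g z)%C.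
Proof.
  intros Hg Hf Hf'. apply functional_extensionality. intros z.
  destruct (Rlt_dec (Cmod z) 1) as [Hz|Hz].
  - rewrite !alexander_in by exact Hz.
    assert (I1 := alexander_ex_integral alpha g0 f z Hg Hf Hz).
    assert (I2 := alexander_ex_integral alpha g0 g z Hg Hf' Hz).
    refine (eq_trans _ (RInt_plus (V := C_R_CompleteNormedModule) _ _ _ _ I1 I2)).
    apply (RInt_ext (V := C_R_CompleteNormedModule)). intros t _.
    change (alexander_integrand g0 (fun z => f z + g z)%C z t =
      alexander_integrand g0 f z t + alexander_integrand g0 g z t)%C.
    match goal with |- ?x = ?y => change (@eq C x y) end.
    unfold alexander_integrand, Cdiv. ring.
  - rewrite !alexander_out by exact Hz. ring.
Qed.

Lemma alexander_scal alpha g0 c f :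
  holo_on_D g0 -> inB0 alpha f ->
  alexander_op g0 (fun z => c * f z)%C = (fun z => c * alexander_op g0 f z)%C.
Proof.
  intros Hg Hf. apply functional_extensionality. intros z.
  destruct (Rlt_dec (Cmod z) 1) as [Hz|Hz].
  - rewrite !alexander_in by exact Hz.
    rewrite <- CInt_Cmult by now apply alexander_ex_integral with alpha.
    apply (RInt_ext (V := C_R_CompleteNormedModule)). intros t _.
    match goal with |- ?x = ?y => change (@eq C x y) end.
    unfold alexander_integrand, Cdiv. ring.
  - rewrite !alexander_out by exact Hz. ring.
Qed.

(** * Diagonal extraction *)

Lemma bounded_adherence (v : nat -> R) (B : R) :
  (forall n, Rabs (v n) <= B) ->
  exists x, forall eps N, 0 < eps -> exists p, (N <= p)%nat /\ Rabs (v p - x) < eps.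
Proof.
  intros H.
  destruct (Bolzano_Weierstrass v (fun x => - B <= x <= B) (compact_P3 (- B) B)) as [x Hx].
  { intros n. now apply Rabs_le_between. }
  exists x. intros eps N He.
  destruct (Hx (disc x (mkposreal eps He)) N) as [p [Hp K]].
  - exists (mkposreal eps He). intros y Hy. exact Hy.
  - exists p. split; [exact Hp | exact K].
Qed.

Lemma archimed_inv (eps : R) : 0 < eps -> exists K : nat, forall k, (K <= k)%nat -> / (INR k + 1) < eps.
Proof.
  intros He. destruct (nfloor_ex (/ eps)) as [K HK]; [now apply Rlt_le, Rinv_0_lt_compat|].
  exists K. intros k Hk. apply le_INR in Hk.
  assert (P := Rinv_0_lt_compat _ He).
  rewrite <- (Rinv_inv eps). apply Rinv_0_lt_contravar; lra.
Qed.

(** No nested subsequences are formed. All limits are fixed beforehand as joint cluster points; then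
    stage k picks a later index at which the first k coordinates are within 1/(k+1) of them. *)
Lemma diagonal_extraction (u : nat -> nat -> R) (B : nat -> R) :
  (forall n j, Rabs (u n j) <= B j) ->
  exists (phi : nat -> nat) (l : nat -> R), (forall n, (phi n < phi (S n))%nat) /\
    forall j eps, 0 < eps -> exists N, forall n, (N <= n)%nat -> Rabs (u (phi n) j - l j) < eps.
Proof.
  intros HB.
  (* [Acc J l]: the first [J] entries of [l] form a joint cluster point of the
     first [J] coordinates; the limits are chosen one coordinate at a time. *)
  set (Acc := fun (J : nat) (l : nat -> R) => forall eps N, 0 < eps ->
    exists n, (N <= n)%nat /\ forall j, (j < J)%nat -> Rabs (u n j - l j) < eps).
  set (upd := fun (l : nat -> R) (J : nat) (x : R) (j : nat) => if Nat.eq_dec j J then x else l j).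
  assert (Hstep : forall J l, Acc J l -> exists x, Acc (S J) (upd l J x)).
  { intros J l HA.
    assert (Hc : forall k, exists n, (k <= n)%nat /\ forall j, (j < J)%nat -> Rabs (u n j - l j) < / (INR k + 1)).
    { intros k. apply HA. apply Rinv_0_lt_compat. generalize (pos_INR k). lra. }
    set (c := fun k => proj1_sig (constructive_indefinite_description _ (Hc k))).
    assert (Hcs : forall k, (k <= c k)%nat /\ forall j, (j < J)%nat -> Rabs (u (c k) j - l j) < / (INR k + 1))
      by (intros k; exact (proj2_sig (constructive_indefinite_description _ (Hc k)))).
    (* Along [c] the first J coordinates converge to their limits, so any cluster point of
       coordinate J along [c] is joint with them. *)
    destruct (bounded_adherence (fun k => u (c k) J) (B J)) as [x Hx]; [intros; apply HB|].
    exists x. intros eps N He.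
    destruct (archimed_inv eps He) as [K HK].
    destruct (Hx eps (max N K) He) as [p [Hp Kp]].
    exists (c p). destruct (Hcs p) as [C1 C2]. split; [lia|].
    intros j Hj. unfold upd. destruct (Nat.eq_dec j J) as [->|Hn]; [exact Kp|].
    eapply Rlt_trans; [apply C2; lia | apply HK; lia]. }
  assert (H0 : Acc O (fun _ => 0)) by (intros eps N _; exists N; split; [lia | intros; lia]).
  set (F := fun J => nat_rect (fun J => {l | Acc J l}) (exist _ _ H0)
    (fun J r => let (x, Hx) := constructive_indefinite_description _ (Hstep J (proj1_sig r) (proj2_sig r))
                in exist _ (upd (proj1_sig r) J x) Hx) J).
  assert (HF : forall J j, j <> J -> proj1_sig (F (S J)) j = proj1_sig (F J) j).
  { intros J j Hj. unfold F. simpl.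
    destruct constructive_indefinite_description as [x Hx]. simpl. unfold upd.
    destruct (Nat.eq_dec j J); [contradiction | reflexivity]. }
  set (l := fun j => proj1_sig (F (S j)) j).
  assert (Hl : forall J j, (j < J)%nat -> proj1_sig (F J) j = l j).
  { induction J as [|J IH]; [intros; lia|]. intros j Hj.
    destruct (Nat.eq_dec j J) as [->|Hn]; [reflexivity|]. rewrite HF by exact Hn. apply IH. lia. }
  assert (HA : forall J, Acc J l).
  { intros J eps N He. destruct (proj2_sig (F J) eps N He) as [n [Hn K]].
    exists n. split; [exact Hn|]. intros j Hj. rewrite <- (Hl J j Hj). now apply K. }
  assert (Hc : forall k N, exists n, (N <= n)%nat /\ forall j, (j < k)%nat -> Rabs (u n j - l j) < / (INR k + 1)).
  { intros k N. apply HA. apply Rinv_0_lt_compat. generalize (pos_INR k). lra. }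
  set (c := fun k N => proj1_sig (constructive_indefinite_description _ (Hc k N))).
  assert (Hcs : forall k N, (N <= c k N)%nat /\ forall j, (j < k)%nat -> Rabs (u (c k N) j - l j) < / (INR k + 1))
    by (intros k N; exact (proj2_sig (constructive_indefinite_description _ (Hc k N)))).
  exists (nat_rect (fun _ => nat) O (fun k p => c k (S p))), l. split.
  - intros n. simpl. apply Hcs.
  - intros j eps He. destruct (archimed_inv eps He) as [K HK].
    (* Index S n of the subsequence comes from stage n, which controls only the coordinates j <
       n. *)
    exists (S (max K (S j))). intros [|n] Hn; [lia|]. simpl.
    eapply Rlt_trans; [apply Hcs; lia | apply HK; lia].
Qed.

(** * Convergence of complex sequences *)

Definition cconv (s : nat -> C) (c : C) : Prop :=
  forall eps, 0 < eps -> exists N, forall n, (N <= n)%nat -> Cmod (s n - c)%C <= eps.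

Lemma cconv_complete (s : nat -> C) :
  (forall eps, 0 < eps -> exists N, forall n m, (N <= n)%nat -> (N <= m)%nat -> Cmod (s n - s m)%C <= eps) ->
  exists c, cconv s c.
Proof.
  intros H.
  assert (HR : forall p : C -> R, (forall x y : C, Rabs (p x - p y) <= Cmod (x - y)%C) ->
    exists c : R, is_lim_seq (fun n => p (s n)) c).
  { intros p Hp. apply ex_lim_seq_cauchy_corr. intros eps.
    destruct (H (eps / 2)) as [N HN]; [generalize (cond_pos eps); lra|].
    exists N. intros n m Hn Hm. eapply Rle_lt_trans; [apply Hp|].
    eapply Rle_lt_trans; [now apply HN|]. generalize (cond_pos eps); lra. }
  destruct (HR fst) as [a Ha]; [intros x y; exact (Cmod_fst (x - y)%C)|].
  destruct (HR snd) as [b Hb]; [intros x y; exact (Cmod_snd (x - y)%C)|].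
  apply is_lim_seq_spec in Ha, Hb.
  exists (a, b). intros eps He. assert (He2 : 0 < eps / 2) by lra.
  destruct (Ha (mkposreal _ He2)) as [N1 H1]. destruct (Hb (mkposreal _ He2)) as [N2 H2].
  exists (max N1 N2). intros n Hn.
  specialize (H1 n ltac:(lia)). specialize (H2 n ltac:(lia)). simpl in H1, H2.
  destruct (s n) as [x y]. simpl in H1, H2.
  eapply Rle_trans; [apply Cmod_pair|]. simpl. unfold Rminus in *. lra.
Qed.

Lemma cconv_dist_le (s : nat -> C) (c x : C) (e : R) N :
  cconv s c -> (forall m, (N <= m)%nat -> Cmod (x - s m)%C <= e) -> Cmod (x - c)%C <= e.
Proof.
  intros Hs H. apply le_epsilon. intros eps He.
  destruct (Hs eps He) as [N' HN'].
  eapply Rle_trans; [apply (Cmod_tri3 _ (s (max N N')))|].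
  apply Rplus_le_compat; [apply H; lia | apply HN'; lia].
Qed.

Lemma cconv_minus (s t : nat -> C) (c d : C) :
  cconv s c -> cconv t d -> cconv (fun n => s n - t n)%C (c - d)%C.
Proof.
  intros Hs Ht eps He.
  destruct (Hs (eps / 2)) as [N1 H1]; [lra|]. destruct (Ht (eps / 2)) as [N2 H2]; [lra|].
  exists (max N1 N2). intros n Hn. specialize (H1 n ltac:(lia)). specialize (H2 n ltac:(lia)).
  replace (s n - t n - (c - d))%C with ((s n - c) - (t n - d))%C by ring.
  eapply Rle_trans; [apply Cmod_minus_le|]. lra.
Qed.

(** * Locally uniform limits and their derivatives *)

Definition loc_unif_cauchy (w : nat -> C -> C) : Prop :=
  forall rho eps, rho < 1 -> 0 < eps -> exists N, forall n m, (N <= n)%nat -> (N <= m)%nat ->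
    forall z, Cmod z <= rho -> Cmod (w n z - w m z)%C <= eps.

Lemma loc_unif_cauchy_limit w :
  loc_unif_cauchy w -> exists u : C -> C, forall z, Cmod z < 1 -> cconv (fun n => w n z) (u z).
Proof.
  intros H.
  assert (Hz : forall z, exists c, Cmod z < 1 -> cconv (fun n => w n z) c).
  { intros z. destruct (Rlt_dec (Cmod z) 1) as [Hz|Hz]; [|exists 0%C; intros; contradiction].
    destruct (cconv_complete (fun n => w n z)) as [c Hc]; [|now exists c].
    intros eps He. destruct (H (Cmod z) eps Hz He) as [N HN]. exists N.
    intros n m Hn Hm. apply HN; [exact Hn | exact Hm | lra]. }
  exists (fun z => proj1_sig (constructive_indefinite_description _ (Hz z))).
  intros z. exact (proj2_sig (constructive_indefinite_description _ (Hz z))).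
Qed.

Lemma loc_unif_cauchy_deriv w dw :
  (forall n z, Cmod z < 1 -> cderiv (w n) z (dw n z)) -> loc_unif_cauchy w -> loc_unif_cauchy dw.
Proof.
  intros Hd H rho eps Hrho He.
  destruct (Rle_or_lt 0 rho) as [R0|R0].
  2: { exists O. intros n m _ _ z Hz. generalize (Cmod_ge_0 z). lra. }
  (* Discs of radius 2r centred in |z| <= rho stay in |x| <= (1 + rho)/2. There a difference below
     eps r/4 gives eps in Cauchy's estimate 4M/r. *)
  set (r := (1 - rho) / 4).
  assert (Hr : 0 < r) by (unfold r; lra).
  destruct (H ((1 + rho) / 2) (eps * r / 4)) as [N HN]; [lra | assert (0 < eps * r) by nra; lra |].
  exists N. intros n m Hn Hm z Hz.
  assert (Near : forall x, Cmod (x - z)%C <= 2 * r -> Cmod x <= (1 + rho) / 2).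
  { intros x Hx. generalize (Cmod_reverse x z). unfold r in Hx. lra. }
  replace eps with (4 * (eps * r / 4) / r) by (field; lra).
  apply (cauchy_derivative_bound (fun x => w n x - w m x)%C z r); [exact Hr | | |].
  - intros x Hx. specialize (Near x Hx). eexists. apply cderiv_minus; apply Hd; lra.
  - intros x Hx. apply HN; [exact Hn | exact Hm | now apply Near].
  - apply cderiv_minus; apply Hd; lra.
Qed.

(** By the mean value bound, w_N - w_m has a small Lipschitz constant near z, and letting m tend to
    infinity the same holds for w_N - u. So u inherits the linear approximation of w_N, at the cost
    of three errors eps/3. *)
Lemma cderiv_limit w dw u du :
  (forall n z, Cmod z < 1 -> cderiv (w n) z (dw n z)) -> loc_unif_cauchy dw ->
  (forall z, Cmod z < 1 -> cconv (fun n => w n z) (u z)) ->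
  (forall z, Cmod z < 1 -> cconv (fun n => dw n z) (du z)) ->
  forall z, Cmod z < 1 -> cderiv u z (du z).
Proof.
  intros Hd Hc Hu Hdu z Hz eps He.
  set (rho := (1 + Cmod z) / 2).
  assert (Hrho : Cmod z < rho < 1) by (unfold rho; lra).
  destruct (Hc rho (eps / 3)) as [N HN]; [lra | lra |].
  destruct (Hd N z Hz (eps / 3)) as [d [D K]]; [lra|].
  exists (Rmin d (rho - Cmod z)). split; [apply Rmin_glb_lt; lra|]. intros x Hx.
  assert (X1 := Rlt_le_trans _ _ _ Hx (Rmin_l _ _)).
  assert (X2 := Rlt_le_trans _ _ _ Hx (Rmin_r _ _)).
  assert (Hxr : Cmod x <= rho) by (generalize (Cmod_reverse x z); lra).
  specialize (K x X1).
  assert (B1 : Cmod ((w N x - w N z) - (u x - u z))%C <= eps / 3 * Cmod (x - z)%C).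
  { apply (cconv_dist_le (fun m => w m x - w m z)%C _ _ _ N).
    - apply cconv_minus; apply Hu; lra.
    - intros m Hm.
      replace (w N x - w N z - (w m x - w m z))%C with ((w N x - w m x) - (w N z - w m z))%C by ring.
      apply (cderiv_mean_value (fun y => w N y - w m y)%C). intros t Ht.
      assert (S := segment_convex z x t rho Ht ltac:(lra) Hxr).
      exists (dw N (z + RtoC t * (x - z)) - dw m (z + RtoC t * (x - z)))%C. split.
      + apply cderiv_minus; apply Hd; lra.
      + apply HN; [lia | exact Hm | exact S]. }
  assert (B2 : Cmod (dw N z - du z)%C <= eps / 3).
  { apply (cconv_dist_le (fun m => dw m z) _ _ _ N); [now apply Hdu|].
    intros m Hm. apply HN; [lia | exact Hm | lra]. }
  replace (u x - u z - (x - z) * du z)%C with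
    ((w N x - w N z - (x - z) * dw N z) - ((w N x - w N z) - (u x - u z))
      + (x - z) * (dw N z - du z))%C by ring.
  eapply Rle_trans; [apply Cmod_triangle|].
  eapply Rle_trans; [apply Rplus_le_compat_r, Cmod_minus_le|].
  rewrite Cmod_mult. assert (P := Cmod_ge_0 (x - z)%C). nra.
Qed.

(** * Compactness of the unit ball for locally uniform convergence *)

(** For p, q <= 2(k + 1) these nodes fill the square [-1,1]^2 with mesh 1/(k+1). Nodes outside the
    disc do no harm, as members of [inB0] vanish there. *)
Definition grid (k p q : nat) : C := (INR p / (INR k + 1) - 1, INR q / (INR k + 1) - 1).

Lemma grid_coord (k : nat) (x : R) :
  -1 <= x <= 1 -> exists p, (p <= 2 * (k + 1))%nat /\ Rabs (INR p / (INR k + 1) - 1 - x) <= / (INR k + 1).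
Proof.
  intros Hx. assert (Pk := pos_INR k).
  destruct (nfloor_ex ((x + 1) * (INR k + 1))) as [p Hp]; [apply Rmult_le_pos; lra|].
  assert (I : 0 < / (INR k + 1)) by (apply Rinv_0_lt_compat; lra).
  exists p. split.
  - apply INR_le. rewrite mult_INR, plus_INR. simpl. nra.
  - replace (INR p / (INR k + 1) - 1 - x) with ((INR p - (x + 1) * (INR k + 1)) * / (INR k + 1))
      by (field; lra).
    rewrite Rabs_mult, (Rabs_pos_eq (/ _)) by lra.
    rewrite <- (Rmult_1_l (/ (INR k + 1))) at 2. apply Rmult_le_compat_r; [lra|].
    apply Rabs_le. lra.
Qed.

Lemma grid_dense (k : nat) (z : C) :
  Cmod z <= 1 -> exists p q, (p <= 2 * (k + 1))%nat /\ (q <= 2 * (k + 1))%nat /\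
    Cmod (z - grid k p q)%C <= 2 * / (INR k + 1).
Proof.
  intros Hz. assert (H1 := Cmod_fst z). assert (H2 := Cmod_snd z).
  destruct (grid_coord k (fst z)) as [p [Hp P]]; [apply Rabs_le_between; lra|].
  destruct (grid_coord k (snd z)) as [q [Hq Q]]; [apply Rabs_le_between; lra|].
  exists p, q. split; [exact Hp|]. split; [exact Hq|].
  rewrite Cmod_sym. destruct z as [x y]. eapply Rle_trans; [apply Cmod_pair|].
  simpl in *. unfold Rminus in *. lra.
Qed.

Lemma eventually_forall_le (Q : nat -> nat -> Prop) :
  (forall p, exists N, forall n, (N <= n)%nat -> Q p n) ->
  forall K, exists N, forall p n, (p <= K)%nat -> (N <= n)%nat -> Q p n.
Proof.
  intros H. induction K as [|K [N HN]].
  - destruct (H O) as [N HN]. exists N. intros p n Hp Hn.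
    replace p with O by lia. now apply HN.
  - destruct (H (S K)) as [N' HN']. exists (max N N'). intros p n Hp Hn.
    destruct (Nat.eq_dec p (S K)) as [->|E]; [apply HN'; lia | apply HN; lia].
Qed.

Lemma bloch_ball_grid_subsequence alpha (v : nat -> C -> C) :
  0 < alpha -> (forall n, inB0 alpha (v n)) -> (forall n, bloch_le alpha (v n) 1) ->
  exists phi : nat -> nat, (forall n, (phi n < phi (S n))%nat) /\
    forall k p q, exists c, cconv (fun n => v (phi n) (grid k p q)) c.
Proof.
  intros Ha Hv HN.
  (* A natural number codes a node (k, p, q) together with a choice of real or imaginary part, so
     that real diagonal extraction applies. *)
  set (pt := fun j => let (k, j') := Cantor.of_nat (snd (Cantor.of_nat j)) in
    let (p, q) := Cantor.of_nat j' in grid k p q).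
  set (comp := fun j (z : C) => match fst (Cantor.of_nat j) with O => fst z | S _ => snd z end).
  destruct (diagonal_extraction (fun n j => comp j (v n (pt j))) (fun j => / weight alpha (pt j)))
    as [phi [l [Hphi Hl]]].
  { intros n j.
    assert (B : Cmod (v n (pt j)) <= / weight alpha (pt j)).
    { assert (P := weight_pos alpha (pt j)). assert (P' := Rinv_0_lt_compat _ P).
      destruct (Hv n) as [V1 [V2 [V3 _]]].
      destruct (Rlt_dec (Cmod (pt j)) 1) as [D|D].
      - eapply Rle_trans; [apply (bloch_growth alpha _ 1); auto|].
        unfold Rdiv. rewrite Rmult_1_l. assert (Q := Cmod_ge_0 (pt j)). nra.
      - rewrite V1 by exact D. rewrite Cmod_0. lra. }
    unfold comp. destruct (fst (Cantor.of_nat j));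
      (eapply Rle_trans; [|exact B]); [apply Cmod_fst | apply Cmod_snd]. }
  exists phi. split; [exact Hphi|]. intros k p q.
  set (j := fun b => Cantor.to_nat (b, Cantor.to_nat (k, Cantor.to_nat (p, q)))).
  assert (Hpt : forall b, pt (j b) = grid k p q).
  { intros b. unfold pt, j. rewrite Cantor.cancel_of_to. cbv beta iota delta [snd].
    rewrite Cantor.cancel_of_to, Cantor.cancel_of_to. reflexivity. }
  assert (Hc0 : forall z, comp (j O) z = fst z)
    by (intros z; unfold comp, j; now rewrite Cantor.cancel_of_to).
  assert (Hc1 : forall z, comp (j 1%nat) z = snd z)
    by (intros z; unfold comp, j; now rewrite Cantor.cancel_of_to).
  exists (l (j O), l (j 1%nat)). intros eps He.
  destruct (Hl (j O) (eps / 2)) as [N1 H1]; [lra|].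
  destruct (Hl (j 1%nat) (eps / 2)) as [N2 H2]; [lra|].
  exists (max N1 N2). intros n Hn.
  specialize (H1 n ltac:(lia)). specialize (H2 n ltac:(lia)).
  rewrite Hc0, Hpt in H1. rewrite Hc1, Hpt in H2.
  destruct (v (phi n) (grid k p q)) as [x y]. simpl in H1, H2.
  eapply Rle_trans; [apply Cmod_pair|]. simpl. unfold Rminus in *. lra.
Qed.

(** The Arzela-Ascoli argument: on a smaller disc the Lipschitz constant is common to the whole
    ball, so closeness at finitely many nodes of a fine grid gives uniform closeness. *)
Lemma bloch_ball_subsequence alpha (v : nat -> C -> C) :
  0 < alpha -> (forall n, inB0 alpha (v n)) -> (forall n, bloch_le alpha (v n) 1) ->
  exists phi : nat -> nat, (forall n, (phi n < phi (S n))%nat) /\ loc_unif_cauchy (fun n => v (phi n)).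
Proof.
  intros Ha Hv HN.
  destruct (bloch_ball_grid_subsequence alpha v Ha Hv HN) as [phi [Hphi Hg]].
  exists phi. split; [exact Hphi|]. intros rho eps Hrho He.
  destruct (Rle_or_lt 0 rho) as [R0|R0].
  2: { exists O. intros n m _ _ z Hz. generalize (Cmod_ge_0 z). lra. }
  set (R := (1 + rho) / 2).
  assert (HR : Cmod (RtoC R) = R) by (rewrite Cmod_R; apply Rabs_pos_eq; unfold R; lra).
  set (L := 1 / weight alpha (RtoC R)).
  assert (HL : 0 < L) by (apply Rdiv_lt_0_compat; [lra | apply weight_pos]).
  (* A nearby node is within 2h of z. The first bound keeps it in the disc of radius R, where L is
     valid; the second makes each move to the node cost at most eps/4, leaving eps/2 for the values
     at the node. *)
  destruct (archimed_inv (Rmin ((1 - rho) / 4) (eps / (8 * L)))) as [k Hk].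
  { apply Rmin_glb_lt; [lra | apply Rdiv_lt_0_compat; lra]. }
  specialize (Hk k (le_n k)). set (h := / (INR k + 1)) in *.
  assert (Hk1 := Rlt_le_trans _ _ _ Hk (Rmin_l _ _)).
  assert (Hk2 := Rlt_le_trans _ _ _ Hk (Rmin_r _ _)).
  assert (Hk3 : L * (2 * h) <= eps / 4).
  { apply (Rmult_lt_compat_r (2 * L)) in Hk2; [|lra].
    replace (eps / (8 * L) * (2 * L)) with (eps / 4) in Hk2 by (field; lra). lra. }
  (* The thresholds of the finitely many nodes are merged, first over q and then over p. *)
  destruct (eventually_forall_le (fun p N => forall q n, (q <= 2 * (k + 1))%nat -> (N <= n)%nat ->
    forall m, (N <= m)%nat -> Cmod (v (phi n) (grid k p q) - v (phi m) (grid k p q))%C <= eps / 2))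
    with (K := (2 * (k + 1))%nat) as [N HNg].
  { intros p.
    destruct (eventually_forall_le (fun q N => forall n, (N <= n)%nat -> forall m, (N <= m)%nat ->
      Cmod (v (phi n) (grid k p q) - v (phi m) (grid k p q))%C <= eps / 2))
      with (K := (2 * (k + 1))%nat) as [N HNq].
    - intros q. destruct (Hg k p q) as [c Hc]. destruct (Hc (eps / 4)) as [N HNc]; [lra|].
      exists N. intros N' HN' n Hn m Hm.
      eapply Rle_trans; [apply (Cmod_tri3 _ c)|]. rewrite (Cmod_sym c).
      generalize (HNc n ltac:(lia)) (HNc m ltac:(lia)). lra.
    - exists N. intros N' HN' q n Hq Hn m Hm. now apply (HNq q N'). }
  exists N. intros n m Hn Hm z Hz.
  destruct (grid_dense k z) as [p [q [Hp [Hq Hd]]]]; [lra|]. fold h in Hd.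
  set (g := grid k p q) in *.
  assert (Hgm : Cmod g <= R).
  { generalize (Cmod_reverse g z). rewrite (Cmod_sym g z). unfold R. lra. }
  assert (Lip : forall i, Cmod (v i z - v i g)%C <= eps / 4).
  { intros i. eapply Rle_trans.
    - apply (bloch_lipschitz alpha (v i) 1 g z (RtoC R)); auto.
      + apply (Hv i).
      + rewrite HR. exact Hgm.
      + rewrite HR. unfold R. lra.
      + rewrite HR. unfold R. lra.
    - fold L. nra. }
  assert (G := HNg p N Hp (le_n N) q n Hq Hn m Hm). fold g in G.
  replace (v (phi n) z - v (phi m) z)%C with
    ((v (phi n) z - v (phi n) g) + (v (phi n) g - v (phi m) g) - (v (phi m) z - v (phi m) g))%C by ring.
  eapply Rle_trans; [apply Cmod_minus_le|].
  eapply Rle_trans; [apply Rplus_le_compat_r, Cmod_triangle|].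
  generalize (Lip (phi n)) (Lip (phi m)). lra.
Qed.

(** Pointwise convergence of the derivatives keeps the limit in the unit ball. The last clause is
    uniform smallness of derivatives on smaller discs, the form that [weighted_quot_small]
    consumes. *)
Lemma bloch_ball_compact alpha (v : nat -> C -> C) :
  0 < alpha -> (forall n, inB0 alpha (v n)) -> (forall n, bloch_le alpha (v n) 1) ->
  exists (phi : nat -> nat) (u : C -> C), (forall n, (phi n < phi (S n))%nat) /\
    inB0 alpha u /\ bloch_le alpha u 1 /\
    forall rho eps, rho < 1 -> 0 < eps -> exists N, forall n, (N <= n)%nat ->
      forall z l, Cmod z <= rho -> cderiv (fun w => v (phi n) w - u w)%C z l -> Cmod l <= eps.
Proof.
  intros Ha Hv HN.
  destruct (bloch_ball_subsequence alpha v Ha Hv HN) as [phi [Hphi Hc]].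
  set (w := fun n => v (phi n)) in *.
  assert (Hder : forall n z, exists l, Cmod z < 1 -> cderiv (w n) z l).
  { intros n z. destruct (Rlt_dec (Cmod z) 1) as [Hz|Hz]; [|exists 0%C; intros; contradiction].
    destruct (Hv (phi n)) as [_ [V _]]. destruct (proj1 (holo_cderiv _) V z Hz) as [l Hl]. now exists l. }
  set (dw := fun n z => proj1_sig (constructive_indefinite_description _ (Hder n z))).
  assert (Hdw : forall n z, Cmod z < 1 -> cderiv (w n) z (dw n z))
    by (intros n z; exact (proj2_sig (constructive_indefinite_description _ (Hder n z)))).
  assert (Hdc := loc_unif_cauchy_deriv w dw Hdw Hc).
  destruct (loc_unif_cauchy_limit w Hc) as [u0 Hu0].
  destruct (loc_unif_cauchy_limit dw Hdc) as [du Hdu].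
  (* The limit is unspecified outside the disc; membership in [inB0] demands 0 there. *)
  set (u := fun z => if Rlt_dec (Cmod z) 1 then u0 z else 0%C).
  assert (Hu : forall z, Cmod z < 1 -> cconv (fun n => w n z) (u z))
    by (intros z Hz; unfold u; destruct Rlt_dec; [now apply Hu0 | contradiction]).
  assert (Hud := cderiv_limit w dw u du Hdw Hdc Hu Hdu).
  assert (Hholo : holo_on_D u) by (apply holo_cderiv; intros z Hz; eexists; now apply Hud).
  assert (HB : bloch_le alpha u 1).
  { intros z l Hz Hl. rewrite (cderiv_unique _ _ _ _ Hl (Hud z Hz)).
    assert (W := weight_pos alpha z). assert (W1 := weight_le_1 alpha z Ha Hz).
    apply le_epsilon. intros eps He. destruct (Hdu z Hz eps He) as [N HNd].
    specialize (HNd N (le_n N)).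
    assert (B := HN (phi N) z _ Hz (Hdw N z Hz)).
    assert (T := Cmod_reverse (du z) (dw N z)). rewrite Cmod_sym in T. nra. }
  exists phi, u. split; [exact Hphi|]. split; [|split; [exact HB|]].
  - apply inB0_intro with 1; [| exact Hholo | | exact HB].
    + intros z Hz. unfold u. destruct Rlt_dec; [contradiction | reflexivity].
    + apply Cmod_eq_0. apply Rle_antisym; [|apply Cmod_ge_0].
      replace (u 0%C) with (- (0 - u 0))%C by ring. rewrite Cmod_opp.
      apply (cconv_dist_le (fun n => w n 0%C) _ _ _ O); [apply Hu, disc_0|].
      intros m _. destruct (Hv (phi m)) as [_ [_ [V _]]]. unfold w. rewrite V.
      replace (0 - 0)%C with (RtoC 0) by ring. rewrite Cmod_0. lra.
  - intros rho eps Hrho He. destruct (Hdc rho eps Hrho He) as [N HNd].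
    exists N. intros n Hn z l Hz Hl.
    assert (Hz1 : Cmod z < 1) by lra.
    rewrite (cderiv_unique _ _ _ _ Hl (cderiv_minus _ _ _ _ _ (Hdw n z Hz1) (Hud z Hz1))).
    apply (cconv_dist_le (fun m => dw m z) _ _ _ N); [now apply Hdu|].
    intros m Hm. now apply HNd.
Qed.

(** * Compactness of the Alexander operator *)

Lemma weight_small_near_boundary alpha kappa :
  0 < alpha -> 0 < kappa -> exists rho, 0 < rho < 1 /\
    forall z, rho <= Cmod z -> Cmod z < 1 -> weight alpha z <= kappa.
Proof.
  intros Ha Hk.
  (* Chosen so that t^alpha = kappa; the radius below then gives 1 - |z|^2 <= 2(1 - |z|) <= t. *)
  set (t := Rpower kappa (/ alpha)).
  assert (Ht : 0 < t) by apply exp_pos.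
  set (rho := 1 - Rmin (1 / 2) (t / 2)).
  assert (M1 : Rmin (1 / 2) (t / 2) <= 1 / 2) by apply Rmin_l.
  assert (M2 : Rmin (1 / 2) (t / 2) <= t / 2) by apply Rmin_r.
  assert (M3 : 0 < Rmin (1 / 2) (t / 2)) by (apply Rmin_glb_lt; lra).
  exists rho. split; [unfold rho; lra|]. intros z Hz1 Hz2.
  replace kappa with (Rpower t alpha).
  - unfold weight. apply Rle_Rpower_l; [lra|]. split; [now apply disc_sq|].
    assert (P := Cmod_ge_0 z). unfold rho in Hz1. simpl. nra.
  - unfold t. rewrite Rpower_mult, Rinv_l by lra. now apply Rpower_1.
Qed.

(* The point [z] is compared with the point of modulus [r] on its radius. *)
Lemma bloch_growth_near_boundary alpha N eps :
  0 < alpha -> 0 < N -> 0 < eps -> exists rho, 0 < rho < 1 /\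
    forall f z, holo_on_D f -> f 0%C = 0%C -> bloch_le alpha f N ->
      rho <= Cmod z -> Cmod z < 1 -> weight alpha z * Cmod (f z) <= eps.
Proof.
  intros Ha HN He.
  (* The radial part beyond r costs at most N(1 - r) <= eps/2. With r fixed, |f p| <= N/W, and the
     weight at z is then made small enough for the other eps/2. *)
  set (r := 1 - Rmin (1 / 2) (eps / (2 * N))).
  assert (M1 : Rmin (1 / 2) (eps / (2 * N)) <= 1 / 2) by apply Rmin_l.
  assert (M2 : Rmin (1 / 2) (eps / (2 * N)) <= eps / (2 * N)) by apply Rmin_r.
  assert (M3 : 0 < Rmin (1 / 2) (eps / (2 * N)))
    by (apply Rmin_glb_lt; [lra | apply Rdiv_lt_0_compat; lra]).
  assert (Hr : 1 / 2 <= r < 1) by (unfold r; lra).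
  assert (Er : N * (1 - r) <= eps / 2).
  { apply (Rmult_le_compat_l N) in M2; [|lra].
    replace (N * (eps / (2 * N))) with (eps / 2) in M2 by (field; lra). unfold r. lra. }
  set (W := weight alpha (RtoC r)).
  assert (HW : 0 < W) by apply weight_pos.
  assert (Cr : Cmod (RtoC r) = r) by (rewrite Cmod_R, Rabs_pos_eq; lra).
  destruct (weight_small_near_boundary alpha (eps * W / (2 * N)) Ha) as [rho0 [Hrho Hsmall]].
  { apply Rdiv_lt_0_compat; [nra | lra]. }
  exists (Rmax r rho0). split; [unfold Rmax; destruct Rle_dec; lra|].
  intros f z Hf F0 HB Hz Hz1.
  assert (Hzr := Rle_trans _ _ _ (Rmax_l r rho0) Hz).
  assert (Hzr0 := Rle_trans _ _ _ (Rmax_r r rho0) Hz).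
  specialize (Hsmall z Hzr0 Hz1).
  set (c := Cmod z) in *.
  set (p := (RtoC (r / c) * z)%C).
  assert (Hrc : 0 <= r / c) by (apply Rlt_le, Rdiv_lt_0_compat; lra).
  assert (Hp : Cmod p = r).
  { unfold p. rewrite Cmod_mult, Cmod_R, Rabs_pos_eq by exact Hrc. fold c. field. lra. }
  assert (Hzp : Cmod (z - p)%C = c - r).
  { unfold p. replace (z - RtoC (r / c) * z)%C with (RtoC (1 - r / c) * z)%C by (rewrite RtoC_minus; ring).
    rewrite Cmod_mult, Cmod_R. fold c. rewrite Rabs_pos_eq.
    - field. lra.
    - apply (Rmult_le_reg_r c); [lra|]. unfold Rdiv. rewrite Rmult_0_l, Rmult_minus_distr_r, Rmult_assoc, Rinv_l by lra. lra. }
  assert (B1 := bloch_lipschitz alpha f N p z z Ha Hf HB). fold c in B1.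
  rewrite Hp, Hzp in B1. specialize (B1 Hzr ltac:(lra) Hz1).
  assert (B2 := bloch_growth alpha f N p Ha Hf F0 HB). rewrite Hp in B2. specialize (B2 (proj2 Hr)).
  assert (Ep : weight alpha p = W) by (unfold W, weight; now rewrite Hp, Cr).
  rewrite Ep in B2.
  assert (P := weight_pos alpha z).
  assert (T : Cmod (f z) <= N / weight alpha z * (c - r) + N / W * r)
    by (generalize (Cmod_reverse (f z) (f p)); lra).
  apply (Rmult_le_compat_l (weight alpha z)) in T; [|lra].
  replace (weight alpha z * (N / weight alpha z * (c - r) + N / W * r))
    with (N * (c - r) + weight alpha z * (N / W) * r) in T by (field; lra).
  assert (T2 : weight alpha z * (N / W) <= eps / 2).
  { replace (eps / 2) with (eps * W / (2 * N) * (N / W)) by (field; lra).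
    apply Rmult_le_compat_r; [apply Rlt_le, Rdiv_lt_0_compat; lra | exact Hsmall]. }
  assert (T3 : 0 <= weight alpha z * (N / W))
    by (apply Rmult_le_pos; [lra | apply Rlt_le, Rdiv_lt_0_compat; lra]).
  nra.
Qed.

(** Inside radius rho, small derivatives give |f z| <= eps |z| and the weight is at most 1. Outside,
    the weighted growth estimate applies. *)
Lemma weighted_quot_small alpha N eps :
  0 < alpha -> 0 < N -> 0 < eps -> exists rho, rho < 1 /\
    forall f l, holo_on_D f -> f 0%C = 0%C -> cderiv f 0 l -> bloch_le alpha f N ->
      (forall z m, Cmod z <= rho -> cderiv f z m -> Cmod m <= eps) ->
      forall z, Cmod z < 1 -> weight alpha z * Cmod (quot f l z) <= eps.
Proof.
  intros Ha HN He.
  destruct (bloch_growth_near_boundary alpha N (eps / 2) Ha HN) as [rho0 [Hrho0 HB]]; [lra|].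
  (* With |z| > 1/2 the division by |z| costs at most a factor 2, which the eps/2 above absorbs. *)
  set (rho := Rmax rho0 (1 / 2)).
  assert (R1 : rho0 <= rho) by apply Rmax_l. assert (R2 : 1 / 2 <= rho) by apply Rmax_r.
  assert (R3 : rho < 1) by (unfold rho, Rmax; destruct Rle_dec; lra).
  exists rho. split; [exact R3|].
  intros f l Hf F0 Hl HN' Hsmall z Hz.
  assert (W := weight_pos alpha z). assert (W1 := weight_le_1 alpha z Ha Hz).
  assert (C0 : Cmod 0%C <= rho) by (rewrite Cmod_0; lra).
  destruct (excluded_middle_informative (z = 0%C)) as [->|Z].
  - rewrite quot_0. assert (B := Hsmall 0%C l C0 Hl). assert (P := Cmod_ge_0 l). nra.
  - assert (P : 0 < Cmod z) by now apply Cmod_gt_0.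
    rewrite quot_neq_0, Cmod_div by exact Z.
    apply (Rmult_le_reg_r (Cmod z)); [exact P|].
    replace (weight alpha z * (Cmod (f z) / Cmod z) * Cmod z) with (weight alpha z * Cmod (f z))
      by (field; lra).
    destruct (Rle_or_lt (Cmod z) rho) as [In|Out].
    + assert (B : Cmod (f z - f 0)%C <= eps * Cmod (z - 0)%C).
      { apply cderiv_mean_value. intros t Ht.
        assert (S := segment_convex 0%C z t rho Ht C0 In).
        destruct (proj1 (holo_cderiv f) Hf _ (Rle_lt_trans _ _ _ S R3)) as [m Hm].
        exists m. split; [exact Hm | now apply (Hsmall _ m S)]. }
      rewrite F0, !Cminus_0_r in B. assert (Q := Cmod_ge_0 (f z)). nra.
    + assert (B := HB f z Hf F0 HN' ltac:(lra) Hz). nra.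
Qed.

Lemma inB0_opp alpha f : inB0 alpha f -> inB0 alpha (fun z => - f z)%C.
Proof.
  intros H. replace (fun z => - f z)%C with (fun z => - (1) * f z)%C.
  - now apply inB0_scal.
  - apply functional_extensionality. intros z. ring.
Qed.

Lemma alexander_opp_compact alpha g0 M :
  0 < alpha -> holo_on_D g0 -> (forall z, Cmod z < 1 -> Cmod (g0 z) <= M) ->
  compact_op alpha (fun f z => - alexander_op g0 f z)%C.
Proof.
  intros Ha Hg HM. split; [split; [|split]|].
  - intros f Hf. apply inB0_opp. now apply alexander_inB0 with M.
  - intros f g Hf Hg'. rewrite (alexander_plus alpha) by assumption.
    apply functional_extensionality. intros z. ring.
  - intros c f Hf. rewrite (alexander_scal alpha) by assumption.
    apply functional_extensionality. intros z. ring.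
  - intros v Hv Hv1.
    destruct (bloch_ball_compact alpha v Ha Hv) as [phi [u [Hphi [Hu [Hu1 Hconv]]]]].
    { intros n. now apply bloch_norm_bloch_le. }
    exists phi, (fun z => - alexander_op g0 u z)%C.
    split; [exact Hphi|]. split; [apply inB0_opp; now apply alexander_inB0 with M|].
    apply is_lim_seq_spec. intros eps.
    assert (M0 : 0 <= M) by (generalize (HM 0%C disc_0) (Cmod_ge_0 (g0 0%C)); lra).
    (* The final bound is e M < eps; M + 1 allows M = 0. *)
    set (e := eps / (2 * (M + 1))).
    assert (He : 0 < e) by (apply Rdiv_lt_0_compat; [apply cond_pos | lra]).
    (* The bound 2 is for a difference of two elements of the unit ball. *)
    destruct (weighted_quot_small alpha 2 e Ha ltac:(lra) He) as [rho [Hrho Hsmall]].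
    destruct (Hconv rho e Hrho He) as [N HN].
    exists N. intros n Hn.
    assert (Hn' := Hv (phi n)).
    assert (HT1 := alexander_holo alpha g0 _ Hg Hn'). assert (HT2 := alexander_holo alpha g0 _ Hg Hu).
    destruct Hn' as [_ [V2 [V3 _]]]. destruct Hu as [_ [U2 [U3 _]]].
    destruct (proj1 (holo_cderiv _) V2 0%C disc_0) as [l Hl].
    destruct (proj1 (holo_cderiv _) U2 0%C disc_0) as [m Hm].
    set (d := fun w => (v (phi n) w - u w)%C).
    assert (HD : forall z, Cmod z < 1 -> weight alpha z * Cmod (quot d (l - m) z)%C <= e).
    { apply (Hsmall d (l - m)%C).
      - now apply holo_minus.
      - unfold d. rewrite V3, U3. ring.
      - now apply cderiv_minus.
      - replace 2 with (1 + 1) by ring. apply bloch_le_minus; auto. now apply bloch_norm_bloch_le.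
      - now apply HN. }
    destruct (bloch_norm_le alpha
      (fun z => - alexander_op g0 (v (phi n)) z - - alexander_op g0 u z)%C (e * M)) as [r [-> Hr]].
    { apply holo_cderiv. intros z Hz. eexists.
      apply cderiv_minus; apply cderiv_opp; [now apply (alexander_cderiv g0 _ l) | now apply (alexander_cderiv g0 _ m)]. }
    { intros z k Hz Hk.
      assert (Hk' := cderiv_minus _ _ _ _ _
        (cderiv_opp _ _ _ (alexander_cderiv g0 _ l z Hg V2 V3 Hl Hz))
        (cderiv_opp _ _ _ (alexander_cderiv g0 _ m z Hg U2 U3 Hm Hz))).
      rewrite (cderiv_unique _ _ _ _ Hk Hk').
      replace (- (quot (v (phi n)) l z * g0 z) - - (quot u m z * g0 z))%C
        with (- (quot d (l - m) z * g0 z))%C by (unfold d; rewrite quot_minus; ring).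
      rewrite Cmod_opp, Cmod_mult, <- Rmult_assoc.
      apply Rmult_le_compat; try apply Cmod_ge_0.
      - apply Rmult_le_pos; [apply Rlt_le, weight_pos | apply Cmod_ge_0].
      - now apply HD.
      - now apply HM. }
    simpl. rewrite Rminus_0_r, Rabs_pos_eq by lra.
    assert (Q : e * (M + 1) = eps / 2) by (unfold e; field; lra).
    assert (E0 := cond_pos eps). nra.
Qed.

(** * From compactness to the essential norm *)

Lemma inB0_zero alpha : inB0 alpha (fun _ => 0%C).
Proof.
  apply inB0_intro with 0; try reflexivity.
  - apply holo_cderiv. intros z _. eexists. apply cderiv_const.
  - intros z l _ Hl. rewrite (cderiv_unique _ _ _ _ Hl (cderiv_const _ _)), Cmod_0. lra.
Qed.

Lemma bloch_norm_zero alpha : bloch_norm alpha (fun _ => 0%C) = Finite 0.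
Proof.
  destruct (bloch_norm_le alpha (fun _ => 0%C) 0) as [r [-> Hr]].
  - apply (inB0_zero alpha).
  - intros z l _ Hl. rewrite (cderiv_unique _ _ _ _ Hl (cderiv_const _ _)), Cmod_0. lra.
  - f_equal. lra.
Qed.

Lemma op_norm_zero alpha : op_norm alpha (fun _ _ => 0%C) = Finite 0.
Proof.
  apply is_lub_Rbar_unique. split.
  - intros r [f [_ [_ Hr]]]. rewrite bloch_norm_zero in Hr. injection Hr as <-. simpl. lra.
  - intros b Hb. apply Hb. exists (fun _ => 0%C). split; [apply inB0_zero|].
    rewrite bloch_norm_zero. split; [simpl; lra | reflexivity].
Qed.

(** The zero function lies in the unit ball, and the norm of its image is a nonnegative member of
    the set whose supremum is taken. *)
Lemma op_norm_nonneg alpha T r :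
  (forall f, inB0 alpha f -> inB0 alpha (T f)) -> op_norm alpha T = Finite r -> 0 <= r.
Proof.
  intros HT Hr. assert (H0 := HT _ (inB0_zero alpha)).
  destruct (inB0_bloch_le _ _ H0) as [N [_ HN]].
  destruct (bloch_norm_le alpha _ N (proj1 (proj2 H0)) HN) as [s [Hs Hs0]].
  assert (U : Rbar_le (Finite s) (op_norm alpha T)).
  { apply (proj1 (Lub_Rbar_correct _)). exists (fun _ => 0%C).
    split; [apply inB0_zero|]. rewrite bloch_norm_zero. split; [simpl; lra | exact Hs]. }
  rewrite Hr in U. simpl in U. lra.
Qed.

(** Every compact perturbation still maps the space to itself, so its norm is at least 0; the
    infimum is attained. *)
Lemma ess_norm_compact alpha T :
  (forall f, inB0 alpha f -> inB0 alpha (T f)) ->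
  compact_op alpha (fun f z => - T f z)%C -> ess_norm alpha T = Finite 0.
Proof.
  intros HT HK. apply is_glb_Rbar_unique. split.
  - intros r [K [[[HK0 _] _] Hr]]. apply (op_norm_nonneg alpha) in Hr; [exact Hr|].
    intros f Hf. now apply inB0_plus; [apply HT | apply HK0].
  - intros b Hb. apply Hb. exists (fun f z => - T f z)%C. split; [exact HK|].
    replace (fun (f : C -> C) (z : C) => T f z + - T f z)%C with (fun (_ : C -> C) (_ : C) => RtoC 0).
    + apply op_norm_zero.
    + apply functional_extensionality. intros f. apply functional_extensionality. intros z. ring.
Qed.

Theorem theorem4p2 (alpha : R) (k : nat) (a : nat -> C) (h : C -> C) :
  0 < alpha ->
  (1 <= k)%nat ->
  (forall j, (j < k)%nat -> 0 < Cmod (a j)) ->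
  holo_on_D h ->
  (exists M : R, forall w, inDisc w -> Cmod (h w) <= M) ->
  let g0 := fun w : C => (sum_n a (k - 1) + h w)%C in
  (forall f, inB0 alpha f -> inB0 alpha (alexander_op g0 f)) /\
  ess_norm alpha (alexander_op g0) = Finite 0.
Proof.
  intros Ha _ _ Hh [M HM] g0.
  (* [sum_n] includes its upper index, so this is the sum of the k coefficients a 0, ..., a (k - 1);
     it is a constant, and |g0| <= |s| + M. *)
  set (s := sum_n a (k - 1) : C).
  assert (Hg : holo_on_D g0).
  { apply holo_cderiv. intros z Hz. destruct (proj1 (holo_cderiv h) Hh z Hz) as [l Hl].
    eexists. apply (cderiv_plus (fun _ => s)); [apply cderiv_const | exact Hl]. }
  assert (Hb : forall z, Cmod z < 1 -> Cmod (g0 z) <= Cmod s + M).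
  { intros z Hz. unfold g0. fold s. eapply Rle_trans; [apply Cmod_triangle|].
    apply Rplus_le_compat_l. now apply HM. }
  assert (HT : forall f, inB0 alpha f -> inB0 alpha (alexander_op g0 f))
    by (intros f; now apply alexander_inB0 with (Cmod s + M)).
  split; [exact HT|].
  apply ess_norm_compact; [exact HT|]. now apply alexander_opp_compact with (Cmod s + M).
Qed.
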